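(* Let $G$ be a commutative group and let $h\colon R\to S$ be a morphism of $G$-graded commutative rings. a) $h_*$ commutes with inductive and projective limits, $h^*$ commutes with inductive limits, and $\widetilde h$ commutes with projective limits. b) $h^*$ is exact if and only if the $G$-graded $R$-module $h_*(S)$ is flat; $h^*$ commutes with products if and only if $h_*(S)$ is of finite presentation; and $h^*$ commutes with projective limits if and only if $h_*(S)$ is projective and of finite type. c) $\widetilde h$ is exact if and only if $h_*(S)$ is projective; $\widetilde h$ commutes with direct sums if and only if $h_*(S)$ is small; and $\widetilde h$ commutes with inductive limits if and only if $h_*(S)$ is projective and of finite type.
   Context: All groups and rings are commutative (rings unital). $\mathrm{Mod}^G(R)$ is the category of $G$-graded $R$-modules with degree-preserving $R$-linear maps; $M(g)$ is the shift, $M(g)_{g'}=M_{g+g'}$. The tensor product $M\otimes_RN$ is graded with $x\otimes y$ in degree $\deg x+\deg y$. $\mathrm{Hom}^G_R(M,N)=\bigoplus_{g\in G}\mathrm{Hom}_{\mathrm{Mod}^G(R)}(M,N(g))$, a $G$-graded $R$-module. Inductive limits are colimits, projective limits are limits, all taken in the categories of graded modules (products are formed degreewise); ''commutes'' means that the canonical comparison morphism is an isomorphism. $h_*\colon\mathrm{Mod}^G(S)\to\mathrm{Mod}^G(R)$ is restriction of scalars along $h$. $h^*\colon\mathrm{Mod}^G(R)\to\mathrm{Mod}^G(S)$, $h^*(M)=S\otimes_RM$ (the graded tensor product $h_*(S)\otimes_RM$ with $s(t\otimes x)=(st)\otimes x$). $\widetilde h\colon\mathrm{Mod}^G(R)\to\mathrm{Mod}^G(S)$,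 $\widetilde h(M)=\mathrm{Hom}^G_R(h_*(S),M)$ with $S$-action $(su)(t)=u(st)$. A $G$-graded $R$-module $M$ is: free of finite rank if $M\cong\bigoplus_{i\in I}R(g_i)$ for a finite family $(g_i)_{i\in I}$ in $G$; of finite type (of finite presentation) if there is an exact sequence $L\to M\to0$ ($L'\to L\to M\to0$) in $\mathrm{Mod}^G(R)$ with $L$ (and $L'$) free of finite rank; flat if $M\otimes_R\bullet$ is exact on $\mathrm{Mod}^G(R)$; projective if $\mathrm{Hom}_{\mathrm{Mod}^G(R)}(M,\bullet)$ is exact; small if for every family $(N_j)_{j\in J}$ of $G$-graded $R$-modules the canonical map $\bigoplus_j\mathrm{Hom}_{\mathrm{Mod}^G(R)}(M,N_j)\to\mathrm{Hom}_{\mathrm{Mod}^G(R)}(M,\bigoplus_jN_j)$ is an isomorphism. *)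

(* Defs.v *)
From HB Require Import structures.
From mathcomp Require Import all_boot all_algebra.
From mathcomp Require Import boolp.

Set Implicit Arguments.
Unset Strict Implicit.
Unset Printing Implicit Defensive.

Import GRing.Theory.
Local Open Scope ring_scope.
Local Open Scope quotient_scope.

(******************************************************************************)
(* Mod^G(R) is the category of grMod R and grHom.                             *)
(*   A G-graded ring or module is given by its homogeneous components, as a   *)
(* family of abelian groups indexed by G.  Products are maps                  *)
(*     R a -> M b -> M c    for each proof of a + b = c,                      *)
(* so that associativity and unitality are stated without transport.  Such a  *)
(* family is the same thing as a ring or module that is the direct sum of     *)
(* its components, and all constructions below are formed degree by degree.   *)
(*   In degree g, the graded module Hom^G(M, N) is grHom M (shift g N).       *)
(*   The functors h_*, h^* and h~ attached to h : grRingHom R S are           *)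
(* restriction h, extension h and coextension h; restrS h is h_*(S).          *)
(******************************************************************************)

(* zpres rel is the abelian group generated by T subject to the relations     *)
(* u = v for rel u v; zcong rel is the congruence they generate.              *)
Inductive zexpr (T : Type) : Type :=
| ZGen of T
| ZZero
| ZOpp of zexpr T
| ZAdd of zexpr T & zexpr T.
Arguments ZZero {T}.

HB.instance Definition _ (T : Type) := gen_eqMixin (zexpr T).
HB.instance Definition _ (T : Type) := gen_choiceMixin (zexpr T).

Section Presentation.
Variables (T : Type) (rel : zexpr T -> zexpr T -> Prop).

Inductive zcong : zexpr T -> zexpr T -> Prop :=
| zcong_rel u v : rel u v -> zcong u v
| zcong_refl u : zcong u u
| zcong_sym u v : zcong u v -> zcong v u
| zcong_trans u v w : zcong u v -> zcong v w -> zcong u w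
| zcong_opp u v : zcong u v -> zcong (ZOpp u) (ZOpp v)
| zcong_add u u' v v' :
    zcong u u' -> zcong v v' -> zcong (ZAdd u v) (ZAdd u' v')
| zcong_addA u v w : zcong (ZAdd u (ZAdd v w)) (ZAdd (ZAdd u v) w)
| zcong_addC u v : zcong (ZAdd u v) (ZAdd v u)
| zcong_add0 u : zcong (ZAdd ZZero u) u
| zcong_addN u : zcong (ZAdd (ZOpp u) u) ZZero.

Definition zcongb (u v : zexpr T) : bool := `[< zcong u v >].

Lemma zcongb_refl : reflexive zcongb.
Proof. by move=> u; apply/asboolP; apply: zcong_refl. Qed.

Lemma zcongb_sym : symmetric zcongb.
Proof.
by move=> u v; apply/idP/idP => /asboolP uv; apply/asboolP; apply: zcong_sym.
Qed.

Lemma zcongb_trans : transitive zcongb.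
Proof.
move=> v u w /asboolP uv /asboolP vw; apply/asboolP; exact: zcong_trans uv vw.
Qed.

Canonical zcong_equiv := EquivRel zcongb zcongb_refl zcongb_sym zcongb_trans.

Definition zpres : Type := {eq_quot zcong_equiv}.
HB.instance Definition _ := Choice.copy zpres {eq_quot zcong_equiv}.

Definition zpi (u : zexpr T) : zpres := \pi_{eq_quot zcong_equiv} u.
Definition zrepr (x : zpres) : zexpr T := repr (x : {eq_quot zcong_equiv}).

Lemma zreprK x : zpi (zrepr x) = x.
Proof. exact: reprK. Qed.

Lemma zpi_eq u v : zpi u = zpi v <-> zcong u v.
Proof.
split; first by move=> /eqmodP/asboolP.
by move=> uv; apply/eqmodP/asboolP.
Qed.

Lemma zrepr_pi u : zcong (zrepr (zpi u)) u.
Proof. by apply/zpi_eq; rewrite zreprK. Qed.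

Definition zpres0 : zpres := zpi ZZero.
Definition zpres_opp (x : zpres) : zpres := zpi (ZOpp (zrepr x)).
Definition zpres_add (x y : zpres) : zpres := zpi (ZAdd (zrepr x) (zrepr y)).

Lemma zpi_opp u : zpres_opp (zpi u) = zpi (ZOpp u).
Proof. by apply/zpi_eq/zcong_opp/zrepr_pi. Qed.

Lemma zpi_add u v : zpres_add (zpi u) (zpi v) = zpi (ZAdd u v).
Proof. by apply/zpi_eq/zcong_add; apply: zrepr_pi. Qed.

Lemma zpres_addA : associative zpres_add.
Proof.
move=> x y z; rewrite -(zreprK x) -(zreprK y) -(zreprK z) !zpi_add.
by apply/zpi_eq/zcong_addA.
Qed.

Lemma zpres_addC : commutative zpres_add.
Proof. by move=> x y; apply/zpi_eq/zcong_addC. Qed.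

Lemma zpres_add0 : left_id zpres0 zpres_add.
Proof.
by move=> x; rewrite -(zreprK x) zpi_add; apply/zpi_eq/zcong_add0.
Qed.

Lemma zpres_addN : left_inverse zpres0 zpres_opp zpres_add.
Proof.
by move=> x; rewrite -(zreprK x) zpi_opp zpi_add; apply/zpi_eq/zcong_addN.
Qed.

HB.instance Definition _ := GRing.isZmodule.Build zpres
  zpres_addA zpres_addC zpres_add0 zpres_addN.

Definition zgen (t : T) : zpres := zpi (ZGen t).

Lemma zpiD u v : zpi (ZAdd u v) = zpi u + zpi v.
Proof. by rewrite -zpi_add. Qed.

Section Lift.
Variables (A : zmodType) (f : T -> A).

Fixpoint zeval (u : zexpr T) : A :=
  match u with
  | ZGen t => f t
  | ZZero => 0
  | ZOpp v => - zeval v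
  | ZAdd v w => zeval v + zeval w
  end.

Hypothesis f_rel : forall u v, rel u v -> zeval u = zeval v.

Lemma zeval_cong u v : zcong u v -> zeval u = zeval v.
Proof.
elim=> {u v} /=.
- exact: f_rel.
- by [].
- by move=> u v _ ->.
- by move=> u v w _ -> _ ->.
- by move=> u v _ ->.
- by move=> u u' v v' _ -> _ ->.
- by move=> u v w; rewrite addrA.
- by move=> u v; rewrite addrC.
- by move=> u; rewrite add0r.
- by move=> u; rewrite addNr.
Qed.

Definition zlift (x : zpres) : A := zeval (zrepr x).

Lemma zlift_gen t : zlift (zgen t) = f t.
Proof. exact: zeval_cong (zrepr_pi (ZGen t)). Qed.

Lemma zliftD x y : zlift (x + y) = zlift x + zlift y.
Proof. exact: zeval_cong (zrepr_pi (ZAdd (zrepr x) (zrepr y))). Qed.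

End Lift.

(* Two additive maps agreeing on the generators are equal. *)
Lemma zpres_ext (A : zmodType) (f g : zpres -> A) :
  {morph f : x y / x + y} -> {morph g : x y / x + y} ->
  (forall t, f (zgen t) = g (zgen t)) -> f =1 g.
Proof.
move=> fD gD fg.
have m0 (k : zpres -> A) : {morph k : x y / x + y} -> k 0 = 0.
  by move=> kD; apply: (addrI (k 0)); rewrite -kD !addr0.
have mN (k : zpres -> A) : {morph k : x y / x + y} -> {morph k : x / - x}.
  by move=> kD x; apply: (addrI (k x)); rewrite -kD !subrr m0.
move=> x; rewrite -(zreprK x); elim: (zrepr x) => [t||u IH|u IHu v IHv].
- exact: fg.
- by rewrite (m0 f fD) (m0 g gD).
- by rewrite -zpi_opp (mN f fD) (mN g gD) IH.
- by rewrite zpiD fD gD IHu IHv.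
Qed.

End Presentation.

Section DirectSum.
Variables (J : Type) (A : J -> zmodType).

Inductive zsum_rel : zexpr {j : J & A j} -> zexpr {j : J & A j} -> Prop :=
| zsum_relD j (x y : A j) :
    zsum_rel (ZGen (existT A j (x + y)))
             (ZAdd (ZGen (existT A j x)) (ZGen (existT A j y))).

Definition zsum : zmodType := zpres zsum_rel.

Definition zsum_in (j : J) (x : A j) : zsum := zgen zsum_rel (existT A j x).

Lemma zsum_inD j : {morph @zsum_in j : x y / x + y}.
Proof.
move=> x y; rewrite /zsum_in /zgen -zpiD.
by apply/zpi_eq/zcong_rel/zsum_relD.
Qed.

Section Univ.
Variables (B : zmodType) (f : forall j, A j -> B).

Definition zsum_lift : zsum -> B :=
  @zlift _ zsum_rel B (fun t => f (projT2 t)).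

Hypothesis fD : forall j, {morph @f j : x y / x + y}.

Lemma zsum_lift_rel u v : zsum_rel u v ->
  zeval (fun t : {j : J & A j} => f (projT2 t)) u =
  zeval (fun t : {j : J & A j} => f (projT2 t)) v.
Proof. by case=> j x y /=; rewrite fD. Qed.

Lemma zsum_lift_in j (x : A j) : zsum_lift (zsum_in x) = f x.
Proof. exact: (zlift_gen zsum_lift_rel). Qed.

Lemma zsum_liftD : {morph zsum_lift : x y / x + y}.
Proof. exact: (zliftD zsum_lift_rel). Qed.

End Univ.

Definition zprod : Type := forall j, A j.
HB.instance Definition _ := gen_eqMixin zprod.
HB.instance Definition _ := gen_choiceMixin zprod.

Definition zprod_add (x y : zprod) : zprod := fun j => x j + y j.
Definition zprod_opp (x : zprod) : zprod := fun j => - x j.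
Definition zprod0 : zprod := fun j => 0.

Lemma zprod_addA : associative zprod_add.
Proof.
by move=> x y z; apply: functional_extensionality_dep => j; apply: addrA.
Qed.
Lemma zprod_addC : commutative zprod_add.
Proof.
by move=> x y; apply: functional_extensionality_dep => j; apply: addrC.
Qed.
Lemma zprod_add0 : left_id zprod0 zprod_add.
Proof.
by move=> x; apply: functional_extensionality_dep => j; apply: add0r.
Qed.
Lemma zprod_addN : left_inverse zprod0 zprod_opp zprod_add.
Proof.
by move=> x; apply: functional_extensionality_dep => j; apply: addNr.
Qed.

HB.instance Definition _ := GRing.isZmodule.Build zprod
  zprod_addA zprod_addC zprod_add0 zprod_addN.

End DirectSum.

Record grRing (G : zmodType) := GrRing {
  grcar :> G -> zmodType;
  grone : grcar 0;
  grmul : forall a b c : G, a + b = c -> grcar a -> grcar b -> grcar c;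
  (* additivity on the right follows by commutativity *)
  grmulDl : forall a b c (e : a + b = c) x x' y,
    grmul e (x + x') y = grmul e x y + grmul e x' y;
  grmulC : forall a b c (e : a + b = c) (e' : b + a = c) x y,
    grmul e x y = grmul e' y x;
  grmulA : forall a b c ab bc abc (e1 : a + b = ab) (e2 : ab + c = abc)
      (e3 : b + c = bc) (e4 : a + bc = abc) x y z,
    grmul e2 (grmul e1 x y) z = grmul e4 x (grmul e3 y z);
  grmul1 : forall a (e : 0 + a = a) x, grmul e grone x = x
}.

Record grRingHom (G : zmodType) (R S : grRing G) := GrRingHom {
  rhom :> forall g : G, R g -> S g;
  rhomD : forall g x y, rhom (x + y) = @rhom g x + rhom y;
  rhom1 : rhom (grone R) = grone S;
  rhomM : forall a b c (e : a + b = c) x y,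
    rhom (grmul e x y) = grmul e (rhom x) (rhom y)
}.

Record grMod (G : zmodType) (R : grRing G) := GrMod {
  gmcar :> G -> zmodType;
  act : forall a b c : G, a + b = c -> R a -> gmcar b -> gmcar c;
  actDl : forall a b c (e : a + b = c) r r' x,
    act e (r + r') x = act e r x + act e r' x;
  actDr : forall a b c (e : a + b = c) r x x',
    act e r (x + x') = act e r x + act e r x';
  actA : forall a b c ab bc abc (e1 : a + b = ab) (e2 : ab + c = abc)
      (e3 : b + c = bc) (e4 : a + bc = abc) r s x,
    act e2 (grmul e1 r s) x = act e4 r (act e3 s x);
  act1 : forall a (e : 0 + a = a) x, act e (grone R) x = x
}.

Record grHom (G : zmodType) (R : grRing G) (M N : grMod R) := GrHom {
  hfun :> forall g : G, M g -> N g;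
  hfunD : forall g x y, hfun (x + y) = @hfun g x + hfun y;
  hfunZ : forall a b c (e : a + b = c) (r : R a) (x : M b),
    hfun (act e r x) = act e r (hfun x)
}.

Section Category.
Variables (G : zmodType) (R : grRing G).
Implicit Types M N P : grMod R.

Lemma grHom_ext M N (f f' : grHom M N) : (forall g, f g =1 f' g) -> f = f'.
Proof.
case: f f' => [f fD fZ] [f' f'D f'Z] /= ff'.
have E : f = f'.
  by apply: functional_extensionality_dep => g; apply: funext => x; apply: ff'.
move: fD fZ; rewrite E => fD fZ.
by rewrite (Prop_irrelevance fD f'D) (Prop_irrelevance fZ f'Z).
Qed.

Lemma hfun0 M N (f : grHom M N) g : f g 0 = 0.
Proof. by apply: (addrI (f g 0)); rewrite -hfunD !addr0. Qed.

Lemma hfunN M N (f : grHom M N) g x : f g (- x) = - f g x.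
Proof. by apply: (addrI (f g x)); rewrite -hfunD !subrr hfun0. Qed.

Lemma act0 M a b c (e : a + b = c) (r : R a) : act e r (0 : M b) = 0.
Proof. by apply: (addrI (act e r (0 : M b))); rewrite -actDr !addr0. Qed.

Lemma actN M a b c (e : a + b = c) (r : R a) (x : M b) :
  act e r (- x) = - act e r x.
Proof. by apply: (addrI (act e r x)); rewrite -actDr !subrr act0. Qed.

Definition hid M : grHom M M := @GrHom _ _ M M (fun g x => x)
  (fun g x y => erefl) (fun a b c e r x => erefl).

Lemma hcomp_add M N P (v : grHom N P) (u : grHom M N) g (x y : M g) :
  v g (u g (x + y)) = v g (u g x) + v g (u g y).
Proof. by rewrite !hfunD. Qed.

Lemma hcomp_scale M N P (v : grHom N P) (u : grHom M N) a b c
    (e : a + b = c) (r : R a) (x : M b) :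
  v c (u c (act e r x)) = act e r (v b (u b x)).
Proof. by rewrite !hfunZ. Qed.

Definition hcomp M N P (v : grHom N P) (u : grHom M N) : grHom M P :=
  GrHom (hcomp_add v u) (hcomp_scale v u).

Definition is_iso M N (f : grHom M N) : Prop :=
  exists f' : grHom N M, hcomp f' f = hid M /\ hcomp f f' = hid N.

Section HomGroup.
Variables M N : grMod R.

HB.instance Definition _ := gen_eqMixin (grHom M N).
HB.instance Definition _ := gen_choiceMixin (grHom M N).

Lemma hzero_add g (x y : M g) : (0 : N g) = 0 + 0.
Proof. by rewrite addr0. Qed.
Lemma hzero_scale a b c (e : a + b = c) (r : R a) (x : M b) :
  (0 : N c) = act e r (0 : N b).
Proof. by rewrite act0. Qed.
Definition hzero : grHom M N := @GrHom _ _ M N (fun g x => 0)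
  hzero_add hzero_scale.

Lemma hopp_add (u : grHom M N) g (x y : M g) :
  - u g (x + y) = - u g x + - u g y.
Proof. by rewrite hfunD opprD. Qed.
Lemma hopp_scale (u : grHom M N) a b c (e : a + b = c) (r : R a) (x : M b) :
  - u c (act e r x) = act e r (- u b x).
Proof. by rewrite hfunZ actN. Qed.
Definition hopp (u : grHom M N) : grHom M N := @GrHom _ _ M N
  (fun g x => - u g x) (hopp_add u) (hopp_scale u).

Lemma hadd_add (u v : grHom M N) g (x y : M g) :
  u g (x + y) + v g (x + y) = (u g x + v g x) + (u g y + v g y).
Proof. by rewrite !hfunD addrACA. Qed.
Lemma hadd_scale (u v : grHom M N) a b c (e : a + b = c) (r : R a) (x : M b) :
  u c (act e r x) + v c (act e r x) = act e r (u b x + v b x).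
Proof. by rewrite !hfunZ actDr. Qed.
Definition hadd (u v : grHom M N) : grHom M N := @GrHom _ _ M N
  (fun g x => u g x + v g x) (hadd_add u v) (hadd_scale u v).

Lemma haddA : associative hadd.
Proof. by move=> u v w; apply: grHom_ext => g x; apply: addrA. Qed.
Lemma haddC : commutative hadd.
Proof. by move=> u v; apply: grHom_ext => g x; apply: addrC. Qed.
Lemma hadd0 : left_id hzero hadd.
Proof. by move=> u; apply: grHom_ext => g x; apply: add0r. Qed.
Lemma haddN : left_inverse hzero hopp hadd.
Proof. by move=> u; apply: grHom_ext => g x; apply: addNr. Qed.

HB.instance Definition _ := GRing.isZmodule.Build (grHom M N)
  haddA haddC hadd0 haddN.

End HomGroup.

Definition exact_at (A B C : zmodType) (u : A -> B) (v : B -> C) : Prop :=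
  forall y, v y = 0 <-> exists x, u x = y.

Definition gr_exact M N P (u : grHom M N) (v : grHom N P) : Prop :=
  forall g, exact_at (u g) (v g).

Lemma grmulDr a b c (e : a + b = c) (x : R a) (y y' : R b) :
  grmul e x (y + y') = grmul e x y + grmul e x y'.
Proof.
have e' : b + a = c by rewrite addrC.
by rewrite !(grmulC e e') grmulDl.
Qed.

Definition grself : grMod R :=
  @GrMod _ R R (@grmul _ R) (@grmulDl _ R) grmulDr (@grmulA _ R) (@grmul1 _ R).

Section Shift.
Variables (d : G) (M : grMod R).

Lemma shift_eq (a b c : G) : a + b = c -> a + (d + b) = d + c.
Proof. by move=> <-; rewrite addrCA. Qed.

Definition shift_act a b c (e : a + b = c) (r : R a) (x : M (d + b)) :
  M (d + c) := act (shift_eq e) r x.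

Lemma shift_act1 a (e : 0 + a = a) (x : M (d + a)) :
  shift_act e (grone R) x = x.
Proof. exact: act1. Qed.

Lemma shift_actA a b c ab bc abc (e1 : a + b = ab) (e2 : ab + c = abc)
    (e3 : b + c = bc) (e4 : a + bc = abc) r s (x : M (d + c)) :
  shift_act e2 (grmul e1 r s) x = shift_act e4 r (shift_act e3 s x).
Proof. exact: actA. Qed.

Definition shift : grMod R := @GrMod _ R (fun g => M (d + g)) shift_act
  (fun a b c e r r' x => actDl (shift_eq e) r r' x)
  (fun a b c e r x x' => actDr (shift_eq e) r x x') shift_actA shift_act1.

End Shift.

Definition shift_hom d M N (u : grHom M N) : grHom (shift d M) (shift d N) :=
  @GrHom _ R (shift d M) (shift d N) (fun g => u (d + g))
    (fun g => @hfunD _ _ _ _ u (d + g))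
    (fun a b c e => @hfunZ _ _ _ _ u _ _ _ (shift_eq d e)).

Section GrSum.
Variables (J : Type) (N : J -> grMod R).

Definition gsum_car (g : G) : zmodType := zsum (fun j => N j g).

Definition gsum_in_fun j g (x : N j g) : gsum_car g :=
  @zsum_in J (fun j => N j g) j x.

Definition gsum_act a b c (e : a + b = c) (r : R a) :
    gsum_car b -> gsum_car c :=
  zsum_lift (fun j x => gsum_in_fun (act e r x)).

Lemma gsum_act_in a b c (e : a + b = c) (r : R a) j (x : N j b) :
  gsum_act e r (gsum_in_fun x) = gsum_in_fun (act e r x).
Proof.
apply: (@zsum_lift_in _ (fun j => N j b)) => {x}i x y.
by rewrite actDr; apply: (@zsum_inD _ (fun j => N j c)).
Qed.

Lemma gsum_actDr a b c (e : a + b = c) (r : R a) x x' :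
  gsum_act e r (x + x') = gsum_act e r x + gsum_act e r x'.
Proof.
apply: (@zsum_liftD _ (fun j => N j b)) => {x x'}i x y.
by rewrite actDr; apply: (@zsum_inD _ (fun j => N j c)).
Qed.

Lemma gsum_actDl a b c (e : a + b = c) (r r' : R a) x :
  gsum_act e (r + r') x = gsum_act e r x + gsum_act e r' x.
Proof.
move: x; apply: zpres_ext.
- exact: gsum_actDr.
- by move=> x y; rewrite !gsum_actDr addrACA.
- move=> [j x]; rewrite !gsum_act_in actDl.
  exact: (@zsum_inD _ (fun j => N j c)).
Qed.

Lemma gsum_actA a b c ab bc abc (e1 : a + b = ab) (e2 : ab + c = abc)
    (e3 : b + c = bc) (e4 : a + bc = abc) (r : R a) (s : R b) x :
  gsum_act e2 (grmul e1 r s) x = gsum_act e4 r (gsum_act e3 s x).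
Proof.
move: x; apply: zpres_ext.
- exact: gsum_actDr.
- by move=> x y; rewrite !gsum_actDr.
- by move=> [j x]; rewrite !gsum_act_in (actA _ _ e3 e4).
Qed.

Lemma gsum_act1 a (e : 0 + a = a) x : gsum_act e (grone R) x = x.
Proof.
move: x; apply: (@zpres_ext _ _ _ _ id) => //.
- exact: gsum_actDr.
- by move=> [j x]; rewrite gsum_act_in act1.
Qed.

Definition gsum : grMod R :=
  GrMod gsum_actDl gsum_actDr gsum_actA gsum_act1.

Definition gsum_in (j : J) : grHom (N j) gsum :=
  @GrHom _ R (N j) gsum (@gsum_in_fun j)
    (fun g => @zsum_inD J (fun j => N j g) j)
    (fun a b c e r x => esym (gsum_act_in e r x)).

Section Univ.
Variables (P : grMod R) (f : forall j, grHom (N j) P).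

Definition gsum_lift_fun g : gsum g -> P g := zsum_lift (fun j => f j g).

Lemma gsum_lift_add g (x y : gsum g) :
  gsum_lift_fun (x + y) = gsum_lift_fun x + gsum_lift_fun y.
Proof.
by apply: (@zsum_liftD _ (fun j => N j g)) => j; apply: hfunD.
Qed.

Lemma gsum_lift_in_fun g j (x : N j g) :
  gsum_lift_fun (gsum_in_fun x) = f j g x.
Proof.
by apply: (@zsum_lift_in _ (fun j => N j g)) => i; apply: hfunD.
Qed.

Lemma gsum_lift_scale a b c (e : a + b = c) (r : R a) (x : gsum b) :
  gsum_lift_fun (act e r x) = act e r (gsum_lift_fun x).
Proof.
move: x; apply: zpres_ext.
- by move=> x y; rewrite actDr gsum_lift_add.
- by move=> x y; rewrite gsum_lift_add actDr.
- move=> [j x]; rewrite gsum_lift_in_fun -hfunZ -gsum_lift_in_fun.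
  by congr gsum_lift_fun; apply: gsum_act_in.
Qed.

Definition gsum_lift : grHom gsum P := GrHom gsum_lift_add gsum_lift_scale.

End Univ.
End GrSum.

Section GrProd.
Variables (J : Type) (N : J -> grMod R).

Definition gprod_car (g : G) : zmodType := zprod (fun j => N j g).

Definition gprod_act a b c (e : a + b = c) (r : R a) (x : gprod_car b) :
  gprod_car c := fun j => act e r (x j).

Lemma gprod_actDl a b c (e : a + b = c) (r r' : R a) x :
  gprod_act e (r + r') x = gprod_act e r x + gprod_act e r' x.
Proof. by apply: functional_extensionality_dep => j; apply: actDl. Qed.
Lemma gprod_actDr a b c (e : a + b = c) (r : R a) x x' :
  gprod_act e r (x + x') = gprod_act e r x + gprod_act e r x'.
Proof. by apply: functional_extensionality_dep => j; apply: actDr. Qed.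
Lemma gprod_actA a b c ab bc abc (e1 : a + b = ab) (e2 : ab + c = abc)
    (e3 : b + c = bc) (e4 : a + bc = abc) (r : R a) (s : R b) x :
  gprod_act e2 (grmul e1 r s) x = gprod_act e4 r (gprod_act e3 s x).
Proof. by apply: functional_extensionality_dep => j; apply: actA. Qed.
Lemma gprod_act1 a (e : 0 + a = a) x : gprod_act e (grone R) x = x.
Proof. by apply: functional_extensionality_dep => j; apply: act1. Qed.

Definition gprod : grMod R :=
  GrMod gprod_actDl gprod_actDr gprod_actA gprod_act1.

Definition gprod_proj (j : J) : grHom gprod (N j) :=
  @GrHom _ R gprod (N j) (fun g x => x j)
    (fun g x y => erefl) (fun a b c e r x => erefl).

Section Univ.
Variables (P : grMod R) (f : forall j, grHom P (N j)).

Definition gprod_lift_fun g (x : P g) : gprod g := fun j => f j g x.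

Lemma gprod_lift_add g (x y : P g) :
  gprod_lift_fun (x + y) = gprod_lift_fun x + gprod_lift_fun y.
Proof. by apply: functional_extensionality_dep => j; apply: hfunD. Qed.
Lemma gprod_lift_scale a b c (e : a + b = c) (r : R a) (x : P b) :
  gprod_lift_fun (act e r x) = act e r (gprod_lift_fun x).
Proof. by apply: functional_extensionality_dep => j; apply: hfunZ. Qed.

Definition gprod_lift : grHom P gprod := GrHom gprod_lift_add gprod_lift_scale.

End Univ.
End GrProd.

End Category.

Arguments grself {G} R.
Arguments exact_at {A B C} u v.

Record smallCat := SmallCat {
  ob :> Type;
  arr : ob -> ob -> Type;
  idarr : forall i, arr i i;
  comparr : forall i j k, arr i j -> arr j k -> arr i k;
  comparr1 : forall i j (f : arr i j), comparr (idarr i) f = f;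
  compar1r : forall i j (f : arr i j), comparr f (idarr j) = f;
  comparrA : forall i j k l (f : arr i j) (g : arr j k) (h : arr k l),
    comparr f (comparr g h) = comparr (comparr f g) h
}.

Record diagram (G : zmodType) (R : grRing G) (J : smallCat) := Diagram {
  dob :> J -> grMod R;
  darr : forall i j : J, arr i j -> grHom (dob i) (dob j);
  darr_id : forall i, darr (idarr i) = hid (dob i);
  darr_comp : forall i j k (f : arr i j) (g : arr j k),
    darr (comparr f g) = hcomp (darr g) (darr f)
}.

Section Limits.
Variables (G : zmodType) (R : grRing G) (J : smallCat) (X : diagram R J).

(* In degree g, colim_rel presents the direct sum of the groups X j g modulo  *)
(* the identification of x with its image under each arrow of the diagram.    *)

Inductive colim_rel (g : G) :
    zexpr {j : J & X j g} -> zexpr {j : J & X j g} -> Prop :=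
| colim_relD j (x y : X j g) :
    colim_rel (ZGen (existT (fun j => X j g : Type) j (x + y)))
      (ZAdd (ZGen (existT (fun j => X j g : Type) j x))
            (ZGen (existT (fun j => X j g : Type) j y)))
| colim_relA i j (f : arr i j) (x : X i g) :
    colim_rel (ZGen (existT (fun j => X j g : Type) j (darr X f g x)))
      (ZGen (existT (fun j => X j g : Type) i x)).

Definition colim_car (g : G) : zmodType := zpres (@colim_rel g).

Definition colim_in_fun j g (x : X j g) : colim_car g :=
  zgen (@colim_rel g) (existT (fun j => X j g : Type) j x).

Lemma colim_inD j g (x y : X j g) :
  colim_in_fun (x + y) = colim_in_fun x + colim_in_fun y.
Proof.
rewrite /colim_in_fun /zgen -zpiD.
by apply/zpi_eq/zcong_rel/colim_relD.
Qed.

Lemma colim_inA i j (f : arr i j) g (x : X i g) :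
  colim_in_fun (darr X f g x) = colim_in_fun x.
Proof. by apply/zpi_eq/zcong_rel/colim_relA. Qed.

Section CarLift.
Variables (g : G) (B : zmodType) (f : forall j, X j g -> B).

Definition colim_car_lift : colim_car g -> B :=
  @zlift _ (@colim_rel g) B (fun t => f (projT2 t)).

Hypothesis fD : forall j, {morph @f j : x y / x + y}.
Hypothesis fA : forall i j (k : arr i j) (x : X i g), f (darr X k g x) = f x.

Lemma colim_car_lift_rel u v : colim_rel u v ->
  zeval (fun t : {j : J & X j g} => f (projT2 t)) u =
  zeval (fun t : {j : J & X j g} => f (projT2 t)) v.
Proof. by case=> [j x y|i j k x] /=; rewrite ?fD ?fA. Qed.

Lemma colim_car_lift_in j (x : X j g) : colim_car_lift (colim_in_fun x) = f x.
Proof. exact: (zlift_gen colim_car_lift_rel). Qed.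

Lemma colim_car_liftD : {morph colim_car_lift : x y / x + y}.
Proof. exact: (zliftD colim_car_lift_rel). Qed.

End CarLift.

Definition colim_act a b c (e : a + b = c) (r : R a) :
    colim_car b -> colim_car c :=
  colim_car_lift (fun j x => colim_in_fun (act e r x)).

Lemma colim_act_in a b c (e : a + b = c) (r : R a) j (x : X j b) :
  colim_act e r (colim_in_fun x) = colim_in_fun (act e r x).
Proof.
apply: colim_car_lift_in => [i y z|i k f y].
- by rewrite actDr colim_inD.
- by rewrite -hfunZ colim_inA.
Qed.

Lemma colim_actDr a b c (e : a + b = c) (r : R a) x x' :
  colim_act e r (x + x') = colim_act e r x + colim_act e r x'.
Proof.
apply: colim_car_liftD => [i y z|i k f y].
- by rewrite actDr colim_inD.
- by rewrite -hfunZ colim_inA.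
Qed.

Lemma colim_actDl a b c (e : a + b = c) (r r' : R a) x :
  colim_act e (r + r') x = colim_act e r x + colim_act e r' x.
Proof.
move: x; apply: zpres_ext.
- exact: colim_actDr.
- by move=> x y; rewrite !colim_actDr addrACA.
- by move=> [j x]; rewrite !colim_act_in actDl colim_inD.
Qed.

Lemma colim_actA a b c ab bc abc (e1 : a + b = ab) (e2 : ab + c = abc)
    (e3 : b + c = bc) (e4 : a + bc = abc) (r : R a) (s : R b) x :
  colim_act e2 (grmul e1 r s) x = colim_act e4 r (colim_act e3 s x).
Proof.
move: x; apply: zpres_ext.
- exact: colim_actDr.
- by move=> x y; rewrite !colim_actDr.
- by move=> [j x]; rewrite !colim_act_in (actA _ _ e3 e4).
Qed.

Lemma colim_act1 a (e : 0 + a = a) x : colim_act e (grone R) x = x.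
Proof.
move: x; apply: (@zpres_ext _ _ _ _ id) => //.
- exact: colim_actDr.
- by move=> [j x]; rewrite colim_act_in act1.
Qed.

Definition colim : grMod R :=
  GrMod colim_actDl colim_actDr colim_actA colim_act1.

Definition colim_in (j : J) : grHom (X j) colim :=
  @GrHom _ R (X j) colim (@colim_in_fun j) (@colim_inD j)
    (fun a b c e r x => esym (colim_act_in e r x)).

Lemma colim_in_arr i j (f : arr i j) :
  hcomp (colim_in j) (darr X f) = colim_in i.
Proof. by apply: grHom_ext => g x; apply: colim_inA. Qed.

Section ColimUniv.
Variables (P : grMod R) (f : forall j, grHom (X j) P).
Hypothesis f_arr : forall i j (k : arr i j), hcomp (f j) (darr X k) = f i.

Definition colim_lift_fun g : colim g -> P g :=
  colim_car_lift (fun j => f j g).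

Lemma colim_lift_in_fun g j (x : X j g) :
  colim_lift_fun (colim_in j g x) = f j g x.
Proof.
apply: colim_car_lift_in => [i|i k u y]; first exact: hfunD.
by rewrite -(f_arr u).
Qed.

Lemma colim_lift_add g (x y : colim g) :
  colim_lift_fun (x + y) = colim_lift_fun x + colim_lift_fun y.
Proof.
apply: colim_car_liftD => [i|i k u z]; first exact: hfunD.
by rewrite -(f_arr u).
Qed.

Lemma colim_lift_scale a b c (e : a + b = c) (r : R a) (x : colim b) :
  colim_lift_fun (act e r x) = act e r (colim_lift_fun x).
Proof.
move: x; apply: zpres_ext.
- by move=> x y; rewrite actDr colim_lift_add.
- by move=> x y; rewrite colim_lift_add actDr.
- by move=> [j x]; rewrite colim_lift_in_fun -hfunZ -colim_lift_in_fun hfunZ.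
Qed.

Definition colim_lift : grHom colim P := GrHom colim_lift_add colim_lift_scale.

End ColimUniv.

Record lim_car (g : G) := LimCar {
  lim_val :> forall j, X j g;
  lim_compat : forall i j (f : arr i j), darr X f g (lim_val i) = lim_val j
}.

Lemma lim_car_ext g (x y : lim_car g) : (forall j, x j = y j) -> x = y.
Proof.
case: x y => [x xP] [y yP] /= xy.
have E : x = y by apply: functional_extensionality_dep.
by move: xP; rewrite E => xP; rewrite (Prop_irrelevance xP yP).
Qed.

Section LimGroup.
Variable g : G.
HB.instance Definition _ := gen_eqMixin (lim_car g).
HB.instance Definition _ := gen_choiceMixin (lim_car g).

Definition lim_add (x y : lim_car g) : lim_car g.
Proof.
by exists (fun j => x j + y j) => i j f; rewrite hfunD !lim_compat.
Defined.
Definition lim_opp (x : lim_car g) : lim_car g.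
Proof. by exists (fun j => - x j) => i j f; rewrite hfunN lim_compat. Defined.
Definition lim_zero : lim_car g.
Proof. by exists (fun j => 0) => i j f; rewrite hfun0. Defined.

Lemma lim_addA : associative lim_add.
Proof. by move=> x y z; apply: lim_car_ext => j; apply: addrA. Qed.
Lemma lim_addC : commutative lim_add.
Proof. by move=> x y; apply: lim_car_ext => j; apply: addrC. Qed.
Lemma lim_add0 : left_id lim_zero lim_add.
Proof. by move=> x; apply: lim_car_ext => j; apply: add0r. Qed.
Lemma lim_addN : left_inverse lim_zero lim_opp lim_add.
Proof. by move=> x; apply: lim_car_ext => j; apply: addNr. Qed.

HB.instance Definition _ := GRing.isZmodule.Build (lim_car g)
  lim_addA lim_addC lim_add0 lim_addN.
End LimGroup.

Definition lim_act a b c (e : a + b = c) (r : R a) (x : lim_car b) : lim_car c.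
Proof.
by exists (fun j => act e r (x j)) => i j f; rewrite hfunZ lim_compat.
Defined.

Lemma lim_actDl a b c (e : a + b = c) (r r' : R a) x :
  lim_act e (r + r') x = lim_act e r x + lim_act e r' x.
Proof. by apply: lim_car_ext => j; apply: actDl. Qed.
Lemma lim_actDr a b c (e : a + b = c) (r : R a) (x x' : lim_car b) :
  lim_act e r (x + x') = lim_act e r x + lim_act e r x'.
Proof. by apply: lim_car_ext => j; apply: actDr. Qed.
Lemma lim_actA a b c ab bc abc (e1 : a + b = ab) (e2 : ab + c = abc)
    (e3 : b + c = bc) (e4 : a + bc = abc) (r : R a) (s : R b) x :
  lim_act e2 (grmul e1 r s) x = lim_act e4 r (lim_act e3 s x).
Proof. by apply: lim_car_ext => j; apply: actA. Qed.
Lemma lim_act1 a (e : 0 + a = a) x : lim_act e (grone R) x = x.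
Proof. by apply: lim_car_ext => j; apply: act1. Qed.

Definition lim : grMod R := @GrMod _ R (fun g => lim_car g : zmodType) lim_act
  lim_actDl lim_actDr lim_actA lim_act1.

Definition lim_proj (j : J) : grHom lim (X j) :=
  @GrHom _ R lim (X j) (fun g (x : lim_car g) => x j)
    (fun g x y => erefl) (fun a b c e r x => erefl).

Lemma lim_proj_arr i j (f : arr i j) :
  hcomp (darr X f) (lim_proj i) = lim_proj j.
Proof. by apply: grHom_ext => g x; apply: lim_compat. Qed.

Section LimUniv.
Variables (P : grMod R) (f : forall j, grHom P (X j)).
Hypothesis f_arr : forall i j (k : arr i j), hcomp (darr X k) (f i) = f j.

Definition lim_lift_fun g (x : P g) : lim g.
Proof. by exists (fun j => f j g x) => i j k; rewrite -(f_arr k). Defined.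

Lemma lim_lift_add g (x y : P g) :
  lim_lift_fun (x + y) = lim_lift_fun x + lim_lift_fun y.
Proof. by apply: lim_car_ext => j; apply: hfunD. Qed.
Lemma lim_lift_scale a b c (e : a + b = c) (r : R a) (x : P b) :
  lim_lift_fun (act e r x) = act e r (lim_lift_fun x).
Proof. by apply: lim_car_ext => j; apply: hfunZ. Qed.

Definition lim_lift : grHom P lim := GrHom lim_lift_add lim_lift_scale.

End LimUniv.
End Limits.

Record grFunctor (G : zmodType) (R S : grRing G) := GrFunctor {
  fob :> grMod R -> grMod S;
  fmap : forall M N, grHom M N -> grHom (fob M) (fob N);
  fmap_id : forall M, fmap (hid M) = hid (fob M);
  fmap_comp : forall M N P (v : grHom N P) (u : grHom M N),
    fmap (hcomp v u) = hcomp (fmap v) (fmap u)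
}.

Section Commutation.
Variables (G : zmodType) (R S : grRing G) (F : grFunctor R S).

Definition exact_functor : Prop :=
  forall (M N P : grMod R) (u : grHom M N) (v : grHom N P),
    gr_exact u v -> gr_exact (fmap F u) (fmap F v).

Definition sum_comparison (J : Type) (N : J -> grMod R) :
    grHom (gsum (fun j => F (N j))) (F (gsum N)) :=
  gsum_lift (fun j => fmap F (gsum_in N j)).

Definition commutes_with_sums : Prop :=
  forall (J : Type) (N : J -> grMod R), is_iso (sum_comparison N).

Definition prod_comparison (J : Type) (N : J -> grMod R) :
    grHom (F (gprod N)) (gprod (fun j => F (N j))) :=
  gprod_lift (fun j => fmap F (gprod_proj N j)).

Definition commutes_with_products : Prop :=
  forall (J : Type) (N : J -> grMod R), is_iso (prod_comparison N).

Section Diagram.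
Variables (J : smallCat) (X : diagram R J).

Definition fdiagram : diagram S J.
Proof.
exists (fun j => F (X j)) (fun i j f => fmap F (darr X f)).
- by move=> i; rewrite darr_id fmap_id.
- by move=> i j k f g; rewrite darr_comp fmap_comp.
Defined.

Lemma colim_comparison_subproof i j (k : arr i j) :
  hcomp (fmap F (colim_in X j)) (darr fdiagram k) = fmap F (colim_in X i).
Proof. by rewrite -fmap_comp colim_in_arr. Qed.

Definition colim_comparison : grHom (colim fdiagram) (F (colim X)) :=
  colim_lift colim_comparison_subproof.

Lemma lim_comparison_subproof i j (k : arr i j) :
  hcomp (darr fdiagram k) (fmap F (lim_proj X i)) = fmap F (lim_proj X j).
Proof. by rewrite -fmap_comp lim_proj_arr. Qed.

Definition lim_comparison : grHom (F (lim X)) (lim fdiagram) :=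
  lim_lift lim_comparison_subproof.

End Diagram.

Definition commutes_with_inductive_limits : Prop :=
  forall (J : smallCat) (X : diagram R J), is_iso (colim_comparison X).

Definition commutes_with_projective_limits : Prop :=
  forall (J : smallCat) (X : diagram R J), is_iso (lim_comparison X).

End Commutation.

Section Tensor.
Variables (G : zmodType) (R : grRing G).

Section Construction.
Variables M N : grMod R.

Record tgen (k : G) := TGen {
  tdegl : G;
  tdegr : G;
  tdeg : tdegl + tdegr = k;
  tleft : M tdegl;
  tright : N tdegr
}.

(* Degree k of the tensor product is generated by the x (x) y with            *)
(* deg x + deg y = k; the last relation is (r x) (x) y = x (x) (r y).         *)
Inductive tens_rel (k : G) : zexpr (tgen k) -> zexpr (tgen k) -> Prop :=
| tens_relDl p q (e : p + q = k) x x' y :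
    tens_rel (ZGen (TGen e (x + x') y))
             (ZAdd (ZGen (TGen e x y)) (ZGen (TGen e x' y)))
| tens_relDr p q (e : p + q = k) x y y' :
    tens_rel (ZGen (TGen e x (y + y')))
             (ZAdd (ZGen (TGen e x y)) (ZGen (TGen e x y')))
| tens_relZ a p q ap aq (e1 : a + p = ap) (e2 : a + q = aq)
    (e3 : ap + q = k) (e4 : p + aq = k) (r : R a) x y :
    tens_rel (ZGen (TGen e3 (act e1 r x) y)) (ZGen (TGen e4 x (act e2 r y))).

Definition tens (k : G) : zmodType := zpres (@tens_rel k).

Definition tmk k p q (e : p + q = k) (x : M p) (y : N q) : tens k :=
  zgen (@tens_rel k) (TGen e x y).

Lemma tmkDl k p q (e : p + q = k) x x' y :
  tmk e (x + x') y = tmk e x y + tmk e x' y.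
Proof.
by rewrite /tmk /zgen -zpiD; apply/zpi_eq/zcong_rel/tens_relDl.
Qed.

Lemma tmkDr k p q (e : p + q = k) x y y' :
  tmk e x (y + y') = tmk e x y + tmk e x y'.
Proof.
by rewrite /tmk /zgen -zpiD; apply/zpi_eq/zcong_rel/tens_relDr.
Qed.

Lemma tmkZ k a p q ap aq (e1 : a + p = ap) (e2 : a + q = aq)
    (e3 : ap + q = k) (e4 : p + aq = k) (r : R a) x y :
  tmk e3 (act e1 r x) y = tmk e4 x (act e2 r y).
Proof. by apply/zpi_eq/zcong_rel/tens_relZ. Qed.

Section Lift.
Variables (k : G) (B : zmodType).
Variable f : forall p q, p + q = k -> M p -> N q -> B.

Definition tens_lift : tens k -> B :=
  @zlift _ (@tens_rel k) B (fun t => f (tdeg t) (tleft t) (tright t)).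

Definition tens_balanced : Prop :=
  [/\ forall p q (e : p + q = k) x x' y, f e (x + x') y = f e x y + f e x' y,
      forall p q (e : p + q = k) x y y', f e x (y + y') = f e x y + f e x y'
    & forall a p q ap aq (e1 : a + p = ap) (e2 : a + q = aq)
        (e3 : ap + q = k) (e4 : p + aq = k) (r : R a) x y,
        f e3 (act e1 r x) y = f e4 x (act e2 r y)].

Hypothesis fB : tens_balanced.

Lemma tens_lift_rel u v : tens_rel u v ->
  zeval (fun t : tgen k => f (tdeg t) (tleft t) (tright t)) u =
  zeval (fun t : tgen k => f (tdeg t) (tleft t) (tright t)) v.
Proof.
case: fB => fDl fDr fZ.
by case=> [p q e x x' y|p q e x y y'|a p q ap aq e1 e2 e3 e4 r x y] /=;
  [apply: fDl | apply: fDr | apply: fZ].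
Qed.

Lemma tens_lift_mk p q (e : p + q = k) x y : tens_lift (tmk e x y) = f e x y.
Proof. exact: (zlift_gen tens_lift_rel). Qed.

Lemma tens_liftD : {morph tens_lift : x y / x + y}.
Proof. exact: (zliftD tens_lift_rel). Qed.

End Lift.
End Construction.

(* An R-linear action of a graded ring A on the groups underlying M makes the *)
(* tensor product a graded A-module, with s (x (x) y) = (s x) (x) y.  This is *)
(* used for A = R acting on any M and for A = S acting on h_*(S).             *)
Section LeftAction.
Variables (A : grRing G) (M N : grMod R).
Variable sact : forall a b c : G, a + b = c -> A a -> M b -> M c.
Hypothesis sactDl : forall a b c (e : a + b = c) (s s' : A a) (x : M b),
  sact e (s + s') x = sact e s x + sact e s' x.
Hypothesis sactDr : forall a b c (e : a + b = c) (s : A a) (x x' : M b),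
  sact e s (x + x') = sact e s x + sact e s x'.
Hypothesis sactA : forall a b c ab bc abc (e1 : a + b = ab) (e2 : ab + c = abc)
    (e3 : b + c = bc) (e4 : a + bc = abc)
    (s : A a) (s' : A b) (x : M c),
  sact e2 (grmul e1 s s') x = sact e4 s (sact e3 s' x).
Hypothesis sact1 : forall a (e : 0 + a = a) (x : M a), sact e (grone A) x = x.
Hypothesis sact_act : forall a b c bc ac abc (e1 : b + c = bc)
    (e2 : a + bc = abc) (e3 : a + c = ac) (e4 : b + ac = abc)
    (s : A a) (r : R b) (x : M c),
  sact e2 s (act e1 r x) = act e4 r (sact e3 s x).

Lemma tmod_eq (a b c p q : G) : a + b = c -> p + q = b -> (a + p) + q = c.
Proof. by move=> <- <-; rewrite addrA. Qed.

Definition tmod_fun a b c (e : a + b = c) (s : A a) p q (e1 : p + q = b)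
    (x : M p) (y : N q) : tens M N c :=
  tmk (tmod_eq e e1) (sact erefl s x) y.

Lemma tmod_funE a b c (e : a + b = c) (s : A a) p q (e1 : p + q = b)
    (x : M p) (y : N q) ap (e2 : a + p = ap) (e3 : ap + q = c) :
  tmod_fun e s e1 x y = tmk e3 (sact e2 s x) y.
Proof.
rewrite /tmod_fun; case: ap / e2 e3 => e3.
by rewrite (Prop_irrelevance e3 (tmod_eq e e1)).
Qed.

Lemma tmod_fun_balanced a b c (e : a + b = c) (s : A a) :
  tens_balanced (tmod_fun e s).
Proof.
split=> [p q e1 x x' y|p q e1 x y y'|d p q dp dq e1 e2 e3 e4 r x y].
- by rewrite /tmod_fun sactDr tmkDl.
- by rewrite /tmod_fun tmkDr.
- have e5 : d + (a + p) = a + dp by rewrite -e1 addrCA.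
  rewrite /tmod_fun (sact_act e1 erefl erefl e5).
  exact: tmkZ.
Qed.

Definition tmod_act a b c (e : a + b = c) (s : A a) :
    tens M N b -> tens M N c :=
  tens_lift (tmod_fun e s).

Lemma tmod_act_mk a b c (e : a + b = c) (s : A a) p q (e1 : p + q = b)
    (x : M p) (y : N q) ap (e2 : a + p = ap) (e3 : ap + q = c) :
  tmod_act e s (tmk e1 x y) = tmk e3 (sact e2 s x) y.
Proof.
rewrite /tmod_act (tens_lift_mk (tmod_fun_balanced e s)).
exact: tmod_funE.
Qed.

Lemma tmod_actDr a b c (e : a + b = c) (s : A a) x x' :
  tmod_act e s (x + x') = tmod_act e s x + tmod_act e s x'.
Proof. exact: (tens_liftD (tmod_fun_balanced e s)). Qed.

Lemma tmod_actDl a b c (e : a + b = c) (s s' : A a) x :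
  tmod_act e (s + s') x = tmod_act e s x + tmod_act e s' x.
Proof.
move: x; apply: zpres_ext.
- exact: tmod_actDr.
- by move=> x y; rewrite !tmod_actDr addrACA.
- move=> [p q e1 x y].
  by rewrite !(tmod_act_mk _ _ _ _ _ erefl (tmod_eq e e1)) sactDl tmkDl.
Qed.

Lemma tmod_actA a b c ab bc abc (e1 : a + b = ab) (e2 : ab + c = abc)
    (e3 : b + c = bc) (e4 : a + bc = abc) (s : A a) (s' : A b) x :
  tmod_act e2 (grmul e1 s s') x = tmod_act e4 s (tmod_act e3 s' x).
Proof.
move: x; apply: zpres_ext.
- exact: tmod_actDr.
- by move=> x y; rewrite !tmod_actDr.
- move=> [p q e5 x y].
  have e6 : ab + p = a + (b + p) by rewrite -e1 addrA.
  have e7 : a + (b + p) + q = abc by rewrite -e2 -e1 -e5 !addrA.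
  rewrite (tmod_act_mk _ _ _ _ _ e6 e7).
  rewrite (tmod_act_mk _ _ _ _ _ erefl (tmod_eq e3 e5)).
  by rewrite (tmod_act_mk _ _ _ _ _ erefl e7) (sactA e1 e6 erefl erefl).
Qed.

Lemma tmod_act1 a (e : 0 + a = a) x : tmod_act e (grone A) x = x.
Proof.
move: x; apply: (@zpres_ext _ _ _ _ id) => //.
- exact: tmod_actDr.
- move=> [p q e1 x y].
  by rewrite (tmod_act_mk _ _ _ _ _ (add0r p) e1) sact1.
Qed.

Definition tmod : grMod A := GrMod tmod_actDl tmod_actDr tmod_actA tmod_act1.

End LeftAction.

Section RightMap.
Variables (M N N' : grMod R) (u : grHom N N').

Definition tmap_fun k p q (e : p + q = k) (x : M p) (y : N q) : tens M N' k :=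
  tmk e x (u q y).

Lemma tmap_fun_balanced k : tens_balanced (@tmap_fun k).
Proof.
split=> [p q e1 x x' y|p q e1 x y y'|d p q dp dq e1 e2 e3 e4 r x y].
- exact: tmkDl.
- by rewrite /tmap_fun hfunD tmkDr.
- by rewrite /tmap_fun hfunZ; apply: tmkZ.
Qed.

Definition tmap k : tens M N k -> tens M N' k := tens_lift (@tmap_fun k).

Lemma tmap_mk k p q (e : p + q = k) (x : M p) (y : N q) :
  tmap (tmk e x y) = tmk e x (u q y).
Proof. exact: (tens_lift_mk (@tmap_fun_balanced k)). Qed.

Lemma tmapD k (x y : tens M N k) : tmap (x + y) = tmap x + tmap y.
Proof. exact: (tens_liftD (@tmap_fun_balanced k)). Qed.

End RightMap.

Lemma tmap_id M N k (x : tens M N k) : tmap (hid N) x = x.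
Proof.
move: x; apply: (@zpres_ext _ _ _ _ id) => // [|[p q e x y]].
- exact: tmapD.
- exact: tmap_mk.
Qed.

Lemma tmap_comp M N N' N'' (v : grHom N' N'') (u : grHom N N') k
    (x : tens M N k) : tmap (hcomp v u) x = tmap v (tmap u x).
Proof.
move: x; apply: zpres_ext => [||[p q e x y]].
- exact: tmapD.
- by move=> x y; rewrite !tmapD.
- by rewrite !tmap_mk.
Qed.

Section TensorFunctor.
Variable M : grMod R.

Lemma act_act a b c bc ac abc (e1 : b + c = bc)
    (e2 : a + bc = abc) (e3 : a + c = ac) (e4 : b + ac = abc)
    (s : R a) (r : R b) (x : M c) :
  act e2 s (act e1 r x) = act e4 r (act e3 s x).
Proof.
have e5 : (a + b) + c = abc by rewrite -e2 -e1 addrA.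
have e6 : b + a = a + b by rewrite addrC.
by rewrite -(actA erefl e5) -(actA e6 e5) (grmulC _ e6).
Qed.

Definition tensor (N : grMod R) : grMod R :=
  tmod N (@actDl _ _ M) (@actDr _ _ M) (@actA _ _ M) (@act1 _ _ M)
    act_act.

Lemma tensor_map_scale N N' (u : grHom N N') a b c (e : a + b = c) (r : R a)
    (x : tensor N b) : tmap u (act e r x) = act e r (tmap u x : tensor N' b).
Proof.
move: x; apply: zpres_ext => [x y|x y|[p q e1 x y]].
- by rewrite actDr tmapD.
- by rewrite tmapD actDr.
- have e2 : (a + p) + q = c := tmod_eq e e1.
  rewrite tmap_mk /=.
  rewrite [X in tmap u X](@tmod_act_mk R M N _ (@actDr _ _ M) act_act
    _ _ _ e r _ _ e1 x y _ erefl e2).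
  rewrite [RHS](@tmod_act_mk R M N' _ (@actDr _ _ M) act_act
    _ _ _ e r _ _ e1 x (u q y) _ erefl e2).
  by rewrite tmap_mk.
Qed.

Definition tensor_map N N' (u : grHom N N') : grHom (tensor N) (tensor N') :=
  @GrHom _ _ (tensor N) (tensor N') (@tmap M N N' u) (@tmapD M N N' u)
    (@tensor_map_scale N N' u).

Definition tensor_functor : grFunctor R R.
Proof.
exists tensor tensor_map.
- by move=> N; apply: grHom_ext => g x; apply: tmap_id.
- by move=> N N' N'' v u; apply: grHom_ext => g x; apply: tmap_comp.
Defined.

End TensorFunctor.
End Tensor.

Section ChangeOfRing.
Variables (G : zmodType) (R S : grRing G) (h : grRingHom R S).

Section Restriction.
Variable M : grMod S.

Definition restr_act a b c (e : a + b = c) (r : R a) (x : M b) : M c :=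
  act e (h a r) x.

Lemma restr_actDl a b c (e : a + b = c) (r r' : R a) (x : M b) :
  restr_act e (r + r') x = restr_act e r x + restr_act e r' x.
Proof. by rewrite /restr_act rhomD actDl. Qed.
Lemma restr_actDr a b c (e : a + b = c) (r : R a) (x x' : M b) :
  restr_act e r (x + x') = restr_act e r x + restr_act e r x'.
Proof. exact: actDr. Qed.
Lemma restr_actA a b c ab bc abc (e1 : a + b = ab) (e2 : ab + c = abc)
    (e3 : b + c = bc) (e4 : a + bc = abc) (r : R a) (s : R b) (x : M c) :
  restr_act e2 (grmul e1 r s) x = restr_act e4 r (restr_act e3 s x).
Proof. by rewrite /restr_act rhomM; apply: actA. Qed.
Lemma restr_act1 a (e : 0 + a = a) (x : M a) : restr_act e (grone R) x = x.
Proof. by rewrite /restr_act rhom1 act1. Qed.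

Definition restr_mod : grMod R :=
  @GrMod _ R M restr_act restr_actDl restr_actDr restr_actA restr_act1.

End Restriction.

Definition restr_map (M N : grMod S) (u : grHom M N) :
    grHom (restr_mod M) (restr_mod N) :=
  @GrHom _ R (restr_mod M) (restr_mod N) u (@hfunD _ _ _ _ u)
    (fun a b c e r x => hfunZ u e (h a r) x).

Definition restriction : grFunctor S R.
Proof.
by exists restr_mod restr_map => *; apply: grHom_ext.
Defined.

Definition restrS : grMod R := restr_mod (grself S).

Lemma grmulCA a b c bc ac abc (e1 : b + c = bc)
    (e2 : a + bc = abc) (e3 : a + c = ac) (e4 : b + ac = abc)
    (s : S a) (t : S b) (x : S c) :
  grmul e2 s (grmul e1 t x) = grmul e4 t (grmul e3 s x).
Proof. exact: (@act_act _ S (grself S)). Qed.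

Definition ext_mod (M : grMod R) : grMod S :=
  @tmod _ R S restrS M (@grmul _ S) (@grmulDl _ S) (@grmulDr _ S) (@grmulA _ S)
    (@grmul1 _ S)
    (fun a b c bc ac abc e1 e2 e3 e4 s r x => grmulCA e1 e2 e3 e4 s (h b r) x).

Lemma ext_act_mk (M : grMod R) a b c (e : a + b = c) (s : S a)
    p q (e1 : p + q = b) (t : S p) (x : M q)
    ap (e2 : a + p = ap) (e3 : ap + q = c) :
  act e s (tmk e1 (t : restrS p) x : ext_mod M b) =
  (tmk e3 (grmul e2 s t : restrS ap) x : ext_mod M c).
Proof.
exact: (@tmod_act_mk _ R S restrS M (@grmul _ S) (@grmulDr _ S)
  (fun a b c bc ac abc e1 e2 e3 e4 s r x => grmulCA e1 e2 e3 e4 s (h b r) x)).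
Qed.

Lemma ext_map_scale (M N : grMod R) (u : grHom M N) a b c (e : a + b = c)
    (s : S a) (x : ext_mod M b) :
  tmap u (act e s x) = act e s (tmap u x : ext_mod N b).
Proof.
move: x; apply: zpres_ext => [x y|x y|[p q e1 t x]].
- by rewrite actDr tmapD.
- by rewrite tmapD actDr.
- have e2 : (a + p) + q = c := tmod_eq e e1.
  rewrite tmap_mk /= [X in tmap u X](ext_act_mk e s e1 t x erefl e2).
  by rewrite [RHS](ext_act_mk e s e1 t (u q x) erefl e2) tmap_mk.
Qed.

Definition ext_map (M N : grMod R) (u : grHom M N) :
    grHom (ext_mod M) (ext_mod N) :=
  @GrHom _ _ (ext_mod M) (ext_mod N) (@tmap _ R restrS M N u)
    (@tmapD _ R restrS M N u) (@ext_map_scale M N u).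

Definition extension : grFunctor R S.
Proof.
exists ext_mod ext_map.
- by move=> N; apply: grHom_ext => g x; apply: tmap_id.
- by move=> N N' N'' v u; apply: grHom_ext => g x; apply: tmap_comp.
Defined.

Definition gcast (C : G -> zmodType) a b (e : a = b) (x : C a) : C b :=
  eq_rect a (fun g => C g : Type) x b e.

Lemma gcast_id (C : G -> zmodType) a (e : a = a) (x : C a) : gcast e x = x.
Proof. by rewrite (Prop_irrelevance e erefl). Qed.

Lemma gcast_comp (C : G -> zmodType) a b c (e : a = b) (e' : b = c)
    (e'' : a = c) (x : C a) : gcast e' (gcast e x) = gcast e'' x.
Proof. by case: b / e e' => e'; rewrite (Prop_irrelevance e' e''). Qed.

Lemma gcastD (C : G -> zmodType) a b (e : a = b) (x y : C a) :
  gcast e (x + y) = gcast e x + gcast e y.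
Proof. by case: b / e. Qed.

Lemma gcast_act (M : grMod R) a b c b' c' (e : a + b = c) (e' : a + b' = c')
    (eb : b = b') (ec : c = c') (r : R a) (x : M b) :
  gcast ec (act e r x) = act e' r (gcast eb x).
Proof.
case: b' / eb e' => e'; case: c' / ec e' => e' /=.
by rewrite (Prop_irrelevance e e').
Qed.

Lemma gcast_hom (M N : grMod R) (u : grHom M N) a b (e : a = b) (x : M a) :
  u b (gcast e x) = gcast e (u a x).
Proof. by case: b / e. Qed.

Section Coextension.
Variable M : grMod R.

Definition coext_car (g : G) : zmodType := grHom restrS (shift g M).

Lemma coext_eq (a g c k l : G) : a + g = c -> a + k = l -> g + l = c + k.
Proof. by move=> <- <-; rewrite addrCA addrA. Qed.

Section Action.
Variables (a g c : G) (e : a + g = c) (s : S a) (u : coext_car g).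

(* (s u)(t) = u (s t); the value lies in degree g + (a + k) of M. *)
Definition coext_act_fun k (t : restrS k) : shift c M k :=
  gcast (C := M) (coext_eq e erefl) (u (a + k) (grmul erefl s t)).

Lemma coext_act_funE k l (e1 : a + k = l) (t : S k) :
  coext_act_fun t = gcast (C := M) (coext_eq e e1) (u l (grmul e1 s t)).
Proof. by case: l / e1. Qed.

Lemma coext_act_add k (t t' : restrS k) :
  coext_act_fun (t + t') = coext_act_fun t + coext_act_fun t'.
Proof. by rewrite /coext_act_fun grmulDr hfunD gcastD. Qed.

Lemma coext_act_scale b k l (e1 : b + k = l) (r : R b) (t : restrS k) :
  coext_act_fun (act e1 r t) = act e1 r (coext_act_fun t).
Proof.
have e2 : b + (a + k) = a + l by rewrite -e1 addrCA.
rewrite /coext_act_fun.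
rewrite [grmul erefl s (act e1 r t)](grmulCA e1 erefl erefl e2 s (h b r) t).
rewrite [u (a + l) _](hfunZ u e2 r (grmul erefl s t)).
exact: (@gcast_act M).
Qed.

Definition coext_act : coext_car c :=
  @GrHom _ R restrS (shift c M) coext_act_fun coext_act_add coext_act_scale.

End Action.

Lemma coext_actDl a b c (e : a + b = c) (s s' : S a) (u : coext_car b) :
  coext_act e (s + s') u = coext_act e s u + coext_act e s' u.
Proof.
apply: grHom_ext => k t.
by rewrite /= /coext_act_fun grmulDl [u _ (_ + _)]hfunD gcastD.
Qed.

Lemma coext_actDr a b c (e : a + b = c) (s : S a) (u u' : coext_car b) :
  coext_act e s (u + u') = coext_act e s u + coext_act e s u'.
Proof. by apply: grHom_ext => k t; apply: (@gcastD M). Qed.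

Lemma coext_actA a b c ab bc abc (e1 : a + b = ab) (e2 : ab + c = abc)
    (e3 : b + c = bc) (e4 : a + bc = abc) (s : S a) (s' : S b)
    (u : coext_car c) :
  coext_act e2 (grmul e1 s s') u = coext_act e4 s (coext_act e3 s' u).
Proof.
apply: grHom_ext => k t /=.
have e5 : ab + k = b + (a + k) by rewrite -e1 addrA (addrC a).
have e6 : b + a = ab by rewrite addrC.
rewrite (coext_act_funE e2 _ _ e5) /coext_act_fun /= /coext_act_fun.
rewrite (grmulC e1 e6) (grmulA e6 e5 erefl erefl).
by rewrite (gcast_comp _ _ (coext_eq e2 e5)).
Qed.

Lemma coext_act1 a (e : 0 + a = a) (u : coext_car a) :
  coext_act e (grone S) u = u.
Proof.
apply: grHom_ext => k t /=.
by rewrite (coext_act_funE e _ _ (add0r k)) grmul1 gcast_id.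
Qed.

Definition coext_mod : grMod S :=
  @GrMod _ S coext_car coext_act coext_actDl coext_actDr coext_actA coext_act1.

End Coextension.

Section CoextensionMap.
Variables (M N : grMod R) (v : grHom M N).

Definition coext_map_fun g (u : coext_mod M g) : coext_mod N g :=
  hcomp (shift_hom g v) u.

Lemma coext_map_add g (u u' : coext_mod M g) :
  coext_map_fun (u + u') = coext_map_fun u + coext_map_fun u'.
Proof. by apply: grHom_ext => k t; apply: hfunD. Qed.

Lemma coext_map_scale a b c (e : a + b = c) (s : S a) (u : coext_mod M b) :
  coext_map_fun (act e s u) = act e s (coext_map_fun u).
Proof. by apply: grHom_ext => k t; apply: (gcast_hom v). Qed.

Definition coext_map : grHom (coext_mod M) (coext_mod N) :=
  GrHom coext_map_add coext_map_scale.

End CoextensionMap.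

Definition coextension : grFunctor R S.
Proof.
exists coext_mod coext_map.
- by move=> M; apply: grHom_ext => g u; apply: grHom_ext.
- by move=> M N P v w; apply: grHom_ext => g u; apply: grHom_ext.
Defined.

End ChangeOfRing.

Section Properties.
Variables (G : zmodType) (R : grRing G).
Implicit Types M N P L : grMod R.

Definition free_finite_rank M : Prop :=
  exists (I : finType) (d : I -> G)
    (f : grHom M (gsum (fun i => shift (d i) (grself R)))), is_iso f.

Definition gr_surjective M N (f : grHom M N) : Prop :=
  forall g (y : N g), exists x, f g x = y.

Definition finite_type M : Prop :=
  exists (L : grMod R) (p : grHom L M), free_finite_rank L /\ gr_surjective p.

Definition finite_presentation M : Prop :=
  exists (L' L : grMod R) (q : grHom L' L) (p : grHom L M),
    [/\ free_finite_rank L', free_finite_rank L, gr_exact q p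
      & gr_surjective p].

Definition flat M : Prop := exact_functor (tensor_functor M).

Definition projective M : Prop :=
  forall (N' N N'' : grMod R) (u : grHom N' N) (v : grHom N N''),
    gr_exact u v ->
    exact_at (hcomp u : grHom M N' -> grHom M N)
             (hcomp v : grHom M N -> grHom M N'').

Definition small_comparison M (J : Type) (N : J -> grMod R) :
    zsum (fun j => grHom M (N j) : zmodType) -> grHom M (gsum N) :=
  zsum_lift (fun j (u : grHom M (N j)) => hcomp (gsum_in N j) u).

Definition small M : Prop :=
  forall (J : Type) (N : J -> grMod R), bijective (@small_comparison M J N).

End Properties.

(* Main.v *)
From mathcomp Require Import boolp.
Require Import Defs.
From mathcomp Require Import all_boot all_algebra.
Import GRing.Theory.

Set Implicit Arguments.
Unset Strict Implicit.
Unset Printing Implicit Defensive.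
Local Open Scope ring_scope.

(******************************************************************************)
(* A dual basis of M is a finite family of m_t in M and linear forms f_t with *)
(* x = sum f_t(x) m_t; M has one iff it is projective and of finite type.  It *)
(* describes the elements of M (x) N and of Hom^G(M, N) by finitely many      *)
(* elements of N, naturally in N, so that M (x) - commutes with limits and    *)
(* Hom^G(M, -) with colimits.  For the converses one diagram is enough:       *)
(* - the modules R(g)^2 indexed by the pairs (x, y) in M_g, with the arrows   *)
(*   that respect the tensors x (x) e_1 + y (x) e_2.  These tensors form an   *)
(*   element of the limit of the M (x) R(g)^2, and the elements of the limit  *)
(*   of the R(g)^2 are linear forms on M, so a preimage sum m_t (x) f_t is a  *)
(*   dual basis;                                                              *)
(* - dually, the modules R(c)^2 over M, with maps (r, s) |-> r x + s y.  Then *)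
(*   M is a retract of their colimit, and a preimage of the section M -> colim*)
(*   in the colimit of the Hom^G(M, R(c)^2) is a dual basis.                  *)
(* If M (x) - commutes with products, lift the family of all x (x) 1, for x   *)
(* homogeneous in M, to M (x) prod R(deg x): its left factors generate M.  If *)
(* L -> M is onto with L free of finite rank, do the same in L for the        *)
(* kernel: the lift vanishes in M (x) prod, so by right exactness its left    *)
(* factors may be taken in the kernel, and they generate it.                  *)
(******************************************************************************)

(** Write T for [restrS h]. In each degree h^* M is T (x) M, and degree g of h~ M is Hom(T, M(g)),
    so every assertion concerns the functors T (x) - and Hom(T, -). Limits and colimits are formed
    degree by degree: restriction leaves the components alone, tensors distribute over generators of
    a colimit, and a compatible family of maps is a map to the limit. Exactness and sums compare
    Hom(T, M) with the groups Hom(T, M(g)), the case g = 0 being plain Hom.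

    The four implications about general limits and colimits go through dual bases ([dual_basisP]).
    From a dual basis, coordinates give explicit inverses of the comparison maps. Towards one,
    commutation is applied to a tautological diagram and the universal element is lifted: a limit
    over elements of M (x) - consists of linear forms ([lim_surjective_dual_basis]), while the
    identity of M factors through a colimit of modules R(c)^2 ([over_section_dual_basis]).

    For products, a finite presentation reduces the claim to finite free modules by a diagram chase
    using right exactness ([ltmap_exact]). Conversely, surjectivity on products yields finite
    generation ([unit_tens_span]), and with injectivity also finitely many relations. *)

Section Presented.
Variables (T : Type) (rel : zexpr T -> zexpr T -> Prop).

Lemma zpres_ind (P : zpres rel -> Prop) :
  (forall t, P (zgen rel t)) -> P 0 -> (forall x, P x -> P (- x)) ->
  (forall x y, P x -> P y -> P (x + y)) -> forall x, P x.
Proof.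
move=> Pgen P0 PN PD x; rewrite -(zreprK x).
elim: (zrepr x) => [t||u IH|u IHu v IHv]; first exact: Pgen.
- exact: P0.
- by rewrite -zpi_opp; apply: PN.
- by rewrite zpiD; apply: PD.
Qed.

End Presented.

Lemma morph_add0 (A B : zmodType) (f : A -> B) :
  {morph f : x y / x + y} -> f 0 = 0.
Proof. by move=> fD; apply: (addrI (f 0)); rewrite -fD !addr0. Qed.

Lemma morph_addN (A B : zmodType) (f : A -> B) :
  {morph f : x y / x + y} -> {morph f : x / - x}.
Proof.
by move=> fD x; apply: (addrI (f x)); rewrite -fD !subrr morph_add0.
Qed.

Lemma morph_addB (A B : zmodType) (f : A -> B) :
  {morph f : x y / x + y} -> {morph f : x y / x - y}.
Proof. by move=> fD x y; rewrite fD (morph_addN fD). Qed.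

Lemma morph_add_sum (A B : zmodType) (f : A -> B) (I : Type) (s : seq I)
    (P : pred I) (F : I -> A) :
  {morph f : x y / x + y} ->
  f (\sum_(i <- s | P i) F i) = \sum_(i <- s | P i) f (F i).
Proof. by move=> fD; apply: big_morph => //; apply: morph_add0. Qed.

Lemma morph_add_inj (A B : zmodType) (f : A -> B) :
  {morph f : x y / x + y} -> (forall x, f x = 0 -> x = 0) -> injective f.
Proof.
move=> fD f0 x y fxy; apply/eqP; rewrite -subr_eq0; apply/eqP/f0.
by rewrite (morph_addB fD) fxy subrr.
Qed.

(** * Isomorphisms, transport of degrees, maps out of R(c) *)

Section Basics.
Variables (G : zmodType) (R : grRing G).
Implicit Types M N P : grMod R.

(** The inverse is chosen degreewise; injectivity of f makes it additive and linear. *)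
Lemma is_isoP M N (f : grHom M N) :
  is_iso f <-> (forall g, injective (f g)) /\ gr_surjective f.
Proof.
split=> [[f' [f'f ff']]|[finj fsurj]].
  have fK g : cancel (f g) (f' g) by move=> x; rewrite -[RHS]/(hid M g x) -f'f.
  split=> [g|g y]; first exact: can_inj (fK g).
  by exists (f' g y); rewrite -[RHS]/(hid N g y) -ff'.
pose f' g y := projT1 (cid (fsurj g y)).
have f'K g y : f g (f' g y) = y by rewrite /f'; case: cid.
have f'D g x y : f' g (x + y) = f' g x + f' g y.
  by apply: finj; rewrite hfunD !f'K.
have f'Z a b c (e : a + b = c) (r : R a) (x : N b) :
    f' c (act e r x) = act e r (f' b x).
  by apply: finj; rewrite hfunZ !f'K.
exists (GrHom f'D f'Z); split; apply: grHom_ext => g x /=; last exact: f'K.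
by apply: finj; rewrite f'K.
Qed.

Lemma hfunB M N (f : grHom M N) g (x y : M g) : f g (x - y) = f g x - f g y.
Proof. by rewrite hfunD hfunN. Qed.

Lemma hfun_sum M N (f : grHom M N) g (I : Type) (s : seq I) (F : I -> M g) :
  f g (\sum_(i <- s) F i) = \sum_(i <- s) f g (F i).
Proof. by apply: morph_add_sum; apply: hfunD. Qed.

Lemma sum_grHomE M N (I : Type) (s : seq I) (F : I -> grHom M N) g (x : M g) :
  (\sum_(i <- s) F i) g x = \sum_(i <- s) F i g x.
Proof. exact: (big_morph (fun f : grHom M N => f g x)). Qed.

Lemma hcompDr M N P (v : grHom N P) (u u' : grHom M N) :
  hcomp v (u + u') = hcomp v u + hcomp v u'.
Proof. by apply: grHom_ext => g x; apply: hfunD. Qed.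

(** Once the casts are eliminated, the two sides differ only in the proof of the degree equation. *)
Lemma act_cast M a a' b b' c (e : a + b = c) (e' : a' + b' = c) (ea : a = a')
    (eb : b = b') (r : R a) (x : M b) :
  act e' (gcast ea r) (gcast eb x) = act e r x.
Proof.
case: a' / ea e' => e'; case: b' / eb e' => e'.
by rewrite (Prop_irrelevance e e').
Qed.

Lemma act_castl M a a' b c (e : a + b = c) (e' : a' + b = c) (ea : a = a')
    (r : R a) (x : M b) :
  act e' (gcast ea r) x = act e r x.
Proof. exact: (act_cast e e' ea erefl). Qed.

Lemma act_one_cast M a b c (e : a + b = c) (ea : 0 = a) (eb : b = c) (x : M b) :
  act e (gcast ea (grone R)) x = gcast eb x.
Proof.
case: a / ea e => e; case: c / eb e => e /=; exact: act1.
Qed.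

Lemma deg_unshift (c g : G) : (c + g) + - c = g.
Proof. by rewrite addrC addKr. Qed.

(* The generator 1 of R(c) has degree - c, so that maps R(c) -> M correspond  *)
(* to elements of M (- c).                                                    *)
Section FreeHom.
Variables (c : G) (M : grMod R) (m : M (- c)).

Definition free_hom_fun g (r : shift c (grself R) g) : M g :=
  act (deg_unshift c g) (r : R (c + g)) m.

Lemma free_hom_add g (r r' : shift c (grself R) g) :
  free_hom_fun (r + r') = free_hom_fun r + free_hom_fun r'.
Proof. exact: actDl. Qed.

Lemma free_hom_scale a b g (e : a + b = g) (s : R a)
    (r : shift c (grself R) b) :
  free_hom_fun (act e s r) = act e s (free_hom_fun r).
Proof. exact: actA. Qed.

Definition free_hom : grHom (shift c (grself R)) M :=
  GrHom free_hom_add free_hom_scale.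

End FreeHom.

Definition unit_shift (c : G) : shift c (grself R) (- c) :=
  gcast (C := R) (esym (subrr c)) (grone R).

Lemma free_hom1 c M (m : M (- c)) : free_hom m (- c) (unit_shift c) = m.
Proof. by rewrite /= /free_hom_fun /unit_shift (act_one_cast _ _ erefl). Qed.

Lemma act_unit_shift c a g (e : a + - c = g) (e' : a = c + g) (r : R a) :
  act e r (unit_shift c) = gcast (C := R) e' r :> R (c + g).
Proof.
have e2 : a + 0 = c + g by rewrite -e' addr0.
have e3 : 0 + a = c + g by rewrite add0r.
transitivity (grmul e2 r (grone R)).
  exact: (act_cast (M := grself R) e2 _ erefl).
rewrite (grmulC e2 e3).
by case: _ / e' e e2 e3 => e e2 e3; rewrite grmul1.
Qed.

(** R(c) is generated by [unit_shift c], since r = r 1, so linearity determines w from one value. *)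
Lemma free_homE c M (w : grHom (shift c (grself R)) M) g r :
  w g r = free_hom (w (- c) (unit_shift c)) g r.
Proof.
rewrite /= /free_hom_fun -hfunZ.
by rewrite (act_unit_shift _ erefl).
Qed.

Lemma free_hom_hcomp c M N (w : grHom M N) (m : M (- c)) g r :
  w g (free_hom m g r) = free_hom (w _ m) g r.
Proof. by rewrite /= /free_hom_fun hfunZ. Qed.

End Basics.

(** * Dual bases *)

Section DualBasis.
Variables (G : zmodType) (R : grRing G).
Implicit Types M N P : grMod R.

(** The degrees of the element and of the form are opposite, so x |-> f(x) m preserves degrees. *)
Definition dual_pair M : Type :=
  {c : G & (M (- c) * grHom M (shift c (grself R)))%type}.

Definition is_dual_basis M (s : seq (dual_pair M)) : Prop :=
  forall g (x : M g),
    x = \sum_(t <- s) free_hom (projT2 t).1 g ((projT2 t).2 g x).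

Definition dual_basis M : Prop := exists s : seq (dual_pair M), is_dual_basis s.

(** The components [M (0 + g)] and [M g] agree only up to transport. This isomorphism and
    [shift0_out] identify degree 0 of Hom^G with the plain group of morphisms. *)
Definition shift0_in M : grHom M (shift 0 M).
Proof.
exists (fun g (x : M g) => gcast (C := M) (esym (add0r g)) x : shift 0 M g).
- by move=> g x y; apply: (@gcastD _ M).
- by move=> a b c e r x; apply: (@gcast_act _ _ M).
Defined.

Definition shift0_out M : grHom (shift 0 M) M.
Proof.
exists (fun g (x : shift 0 M g) => gcast (C := M) (add0r g) x).
- by move=> g x y; apply: (@gcastD _ M).
- by move=> a b c e r x; apply: (@gcast_act _ _ M).
Defined.

Lemma shift0_inK M : hcomp (shift0_out M) (shift0_in M) = hid M.
Proof.
by apply: grHom_ext => g x /=; rewrite (gcast_comp _ _ (erefl g)).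
Qed.

Lemma shift0_outK M : hcomp (shift0_in M) (shift0_out M) = hid (shift 0 M).
Proof.
apply: grHom_ext => g x /=.
by rewrite (gcast_comp _ _ (erefl (0 + g))).
Qed.

Lemma shift0_out_natural M N (u : grHom M N) :
  hcomp (shift0_out N) (shift_hom 0 u) = hcomp u (shift0_out M).
Proof. by apply: grHom_ext => g x /=; rewrite gcast_hom. Qed.

Lemma shift0_in_natural M N (u : grHom M N) :
  hcomp (shift0_in N) u = hcomp (shift_hom 0 u) (shift0_in M).
Proof. by apply: grHom_ext => g x /=; rewrite gcast_hom. Qed.

Section FiniteSum.
Variables (I : Type) (N : I -> grMod R).

(** A Kronecker delta whose entries have dependent types; equality in the arbitrary index type is
    decided classically. *)
Definition gsum_coord_to (i j : I) : grHom (N j) (N i) :=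
  if pselect (j = i) is left e then
    eq_rect j (fun k => grHom (N j) (N k)) (hid (N j)) i e
  else 0.

Definition gsum_coord (i : I) : grHom (gsum N) (N i) :=
  gsum_lift (gsum_coord_to i).

Lemma gsum_coord_in i j :
  hcomp (gsum_coord i) (gsum_in N j) = gsum_coord_to i j.
Proof. by apply: grHom_ext => g x; apply: gsum_lift_in_fun. Qed.

Lemma gsum_coord_to_id i : gsum_coord_to i i = hid (N i).
Proof.
rewrite /gsum_coord_to; case: pselect => // e.
by rewrite (Prop_irrelevance e erefl).
Qed.

Lemma gsum_coord_to_neq i j : j <> i -> gsum_coord_to i j = 0.
Proof. by rewrite /gsum_coord_to; case: pselect. Qed.

Lemma gsum_ext P (u v : grHom (gsum N) P) :
  (forall i, hcomp u (gsum_in N i) = hcomp v (gsum_in N i)) -> u = v.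
Proof.
move=> uv; apply: grHom_ext => g; apply: zpres_ext => [||[j x]].
- exact: (hfunD u).
- exact: (hfunD v).
- exact: (congr1 (fun w : grHom _ _ => w g x) (uv j)).
Qed.

End FiniteSum.

Lemma gsum_id_sum (I : finType) (N : I -> grMod R) :
  hid (gsum N) = \sum_(i : I) hcomp (gsum_in N i) (gsum_coord N i).
Proof.
apply: gsum_ext => j; apply: grHom_ext => g x.
rewrite [RHS]/= sum_grHomE (bigD1 j) //= big1 ?addr0 => [|i ij].
  have /(congr1 (fun w : grHom _ _ => w g x)) /= -> := gsum_coord_in N j j.
  by rewrite gsum_coord_to_id.
have /(congr1 (fun w : grHom _ _ => w g x)) /= -> := gsum_coord_in N i j.
rewrite gsum_coord_to_neq /= => [|ji]; last by rewrite ji eqxx in ij.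
exact: (hfun0 (gsum_in N i)).
Qed.

(** Only the finitely many values y(m_t) have to be lifted through u; the forms f_t then assemble
    the lifts n_t into the map x |-> sum f_t(x) n_t. *)
Lemma dual_basis_projective M : dual_basis M -> projective M.
Proof.
move=> [s sE] N' N N'' u v uv y; split=> [vy|[x <-]]; last first.
  apply: grHom_ext => g x0 /=.
  by apply/(uv g); exists (x g x0).
have lift (t : dual_pair M) :
    exists n : N' (- projT1 t), u _ n = y _ (projT2 t).1.
  apply/(uv _).
  exact: (congr1 (fun w : grHom _ _ => w _ (projT2 t).1) vy).
pose n t := projT1 (cid (lift t)).
have nE t : u _ (n t) = y _ (projT2 t).1 by rewrite /n; case: cid.
exists (\sum_(t <- s) hcomp (free_hom (n t)) (projT2 t).2).
apply: grHom_ext => g x.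
rewrite [LHS]/= sum_grHomE hfun_sum [in RHS](sE g x) hfun_sum.
by apply: eq_bigr => t _; rewrite [LHS]free_hom_hcomp nE free_hom_hcomp.
Qed.

Lemma free_finite_rank_gsum (I : finType) (d : I -> G) :
  free_finite_rank (gsum (fun i => shift (d i) (grself R))).
Proof.
by exists I, d, (hid _), (hid _); split; apply: grHom_ext.
Qed.

(** The last clause serves to show that p lands in a kernel when its generators do. *)
Lemma finite_span M (E : Type) (c : E -> G) (m : forall e, M (- c e))
    (s : seq E) :
  exists (L : grMod R) (p : grHom L M),
    [/\ free_finite_rank L,
        forall g (r : forall e, shift (c e) (grself R) g), exists y,
          p g y = \sum_(e <- s) free_hom (m e) g (r e)
      & forall P (v : grHom M P), (forall e, v _ (m e) = 0) -> hcomp v p = 0].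
Proof.
(* The basis is indexed by positions in s, which form a finite type whatever E is. *)
pose el (i : 'I_(size s)) := tnth (in_tuple s) i.
pose N i := shift (c (el i)) (grself R).
exists (gsum N), (gsum_lift (fun i => free_hom (m (el i)))).
split=> [|g r|P v vm]; first exact: free_finite_rank_gsum.
  exists (\sum_i gsum_in N i g (r (el i))).
  rewrite hfun_sum (big_tnth _ _ s).
  by apply: eq_bigr => i _; apply: gsum_lift_in_fun.
apply: gsum_ext => i; apply: grHom_ext => g x /=.
rewrite gsum_lift_in_fun [LHS](free_hom_hcomp v) vm.
exact: act0.
Qed.

Lemma dual_basis_finite_type M : dual_basis M -> finite_type M.
Proof.
move=> [s sE].
have [L [p [Lfree psurj _]]] :=
  finite_span (fun t : dual_pair M => (projT2 t).1) s.
exists L, p; split=> // g x.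
have [y yE] := psurj g (fun t => (projT2 t).2 g x).
by exists y; rewrite yE -sE.
Qed.

(** Insert the decomposition [gsum_id_sum] between a and b: the elements are the images under a of
    the basis, the forms are the coordinates of b. *)
Lemma retract_dual_basis M (I : finType) (d : I -> G)
    (a : grHom (gsum (fun i => shift (d i) (grself R))) M)
    (b : grHom M (gsum (fun i => shift (d i) (grself R)))) :
  hcomp a b = hid M -> dual_basis M.
Proof.
move=> ab; pose N i := shift (d i) (grself R).
exists [seq existT (fun c => (M (- c) * grHom M (shift c (grself R)))%type)
          (d i) (a _ (gsum_in N i _ (unit_shift R (d i))),
                 hcomp (gsum_coord N i) b) | i <- enum I].
move=> g x; rewrite big_map /= big_enum /=.
transitivity (a g (hid (gsum N) g (b g x))).
  by rewrite -[LHS]/(hid M g x) -ab.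
rewrite gsum_id_sum sum_grHomE hfun_sum.
by apply: eq_bigr => i _; rewrite [LHS](free_homE (hcomp a (gsum_in N i))).
Qed.

Lemma free_finite_rank_dual_basis M : free_finite_rank M -> dual_basis M.
Proof.
by move=> [I [d [phi [psi [psiK _]]]]]; apply: (retract_dual_basis psiK).
Qed.

Lemma dual_basisP M : dual_basis M <-> projective M /\ finite_type M.
Proof.
split=> [Mdb|[Mproj [L [p [[I [d [phi [psi [psiK _]]]]] psurj]]]]].
  by split; [apply: dual_basis_projective | apply: dual_basis_finite_type].
(* Surjectivity of p is phrased as exactness at M, so that projectivity lifts the identity to a
   section of p. *)
have pex : gr_exact p (0 : grHom M M).
  by move=> g y; split=> // _; apply: psurj.
have [w wE] : exists w : grHom M L, hcomp p w = hid M.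
  by apply/(Mproj _ _ _ _ _ pex); apply: grHom_ext.
apply: (@retract_dual_basis _ _ _ (hcomp p psi) (hcomp phi w)).
transitivity (hcomp p (hcomp (hcomp psi phi) w)); first exact: grHom_ext.
by rewrite psiK -wE; apply: grHom_ext.
Qed.

End DualBasis.

(** * Tensor products *)

Section TensElements.
Variables (G : zmodType) (R : grRing G).
Implicit Types M N P : grMod R.

(** The left degree is written [- c] to match dual pairs and [free_hom]. *)
Definition tpure M N c k (x : M (- c)) (y : N (c + k)) : tens M N k :=
  tmk (addKr c k) x y.

Lemma tmk_cast M N p p' q q' k (e : p + q = k) (e' : p' + q' = k)
    (ep : p = p') (eq : q = q') (x : M p) (y : N q) :
  tmk e' (gcast ep x) (gcast eq y) = tmk e x y.
Proof.
case: p' / ep e' => e'; case: q' / eq e' => e'.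
by rewrite (Prop_irrelevance e e').
Qed.

Lemma tmk_tpure M N p q k (e : p + q = k) (x : M p) (y : N q) :
  exists c (x' : M (- c)) (y' : N (c + k)), tmk e x y = tpure x' y'.
Proof.
have ep : p = - - p by rewrite opprK.
have eq : q = - p + k by rewrite -e addKr.
exists (- p), (gcast ep x), (gcast eq y).
by rewrite /tpure (tmk_cast e).
Qed.

Lemma tmk0l M N p q k (e : p + q = k) (y : N q) : tmk e (0 : M p) y = 0.
Proof.
by apply: (@morph_add0 _ _ (fun x : M p => tmk e x y)) => x x'; apply: tmkDl.
Qed.

Lemma tmk0r M N p q k (e : p + q = k) (x : M p) : tmk e x (0 : N q) = 0.
Proof.
by apply: (@morph_add0 _ _ (fun y : N q => tmk e x y)) => y y'; apply: tmkDr.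
Qed.

Lemma tmkNr M N p q k (e : p + q = k) (x : M p) (y : N q) :
  tmk e x (- y) = - tmk e x y.
Proof.
apply: (@morph_addN _ _ (fun y : N q => tmk e x y)) => {}y y'; exact: tmkDr.
Qed.

Lemma tmk_suml M N p q k (e : p + q = k) (y : N q) (I : Type) (s : seq I)
    (F : I -> M p) :
  tmk e (\sum_(i <- s) F i) y = \sum_(i <- s) tmk e (F i) y.
Proof.
by apply: (@morph_add_sum _ _ (fun x : M p => tmk e x y)) => x x'; apply: tmkDl.
Qed.

Lemma tens_sum M N k (z : tens M N k) :
  exists s : seq {c : G & (M (- c) * N (c + k)%R)%type},
    z = \sum_(t <- s) tpure (projT2 t).1 (projT2 t).2.
Proof.
elim/zpres_ind: z => [[p q e x y]||z [s ->]|z z' [s ->] [s' ->]].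
- have [c [x' [y' E]]] := tmk_tpure e x y.
  exists [:: existT (fun c => (M (- c) * N (c + k)%R)%type) c (x', y')].
  by rewrite big_seq1.
- by exists [::]; rewrite big_nil.
(* The sign is absorbed by the right factors. *)
- exists [seq existT (fun c => (M (- c) * N (c + k)%R)%type) (projT1 t)
            ((projT2 t).1, - (projT2 t).2) | t <- s].
  by rewrite big_map -sumrN; apply: eq_bigr => t _; rewrite /tpure tmkNr.
- by exists (s ++ s'); rewrite big_cat.
Qed.

Lemma tens_ext M N k (B : zmodType) (f f' : tens M N k -> B) :
  {morph f : x y / x + y} -> {morph f' : x y / x + y} ->
  (forall p q (e : p + q = k) x y, f (tmk e x y) = f' (tmk e x y)) -> f =1 f'.
Proof.
by move=> fD f'D ff'; apply: zpres_ext => // -[p q e x y]; apply: ff'.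
Qed.

Lemma tmap_sum M N N' (u : grHom N N') k (I : Type) (s : seq I)
    (F : I -> tens M N k) :
  tmap u (\sum_(i <- s) F i) = \sum_(i <- s) tmap u (F i).
Proof. exact/morph_add_sum/tmapD. Qed.

Lemma tmap_tpure M N N' (u : grHom N N') c k (x : M (- c)) (y : N (c + k)) :
  tmap u (tpure x y) = tpure x (u _ y).
Proof. exact: tmap_mk. Qed.

Section Contraction.
Variables (M N : grMod R) (c : G) (f : grHom M (shift c (grself R))).

Lemma contract_eq p q k : p + q = k -> (c + p) + q = c + k.
Proof. by move=> <-; rewrite addrA. Qed.

(** This is f (x) N followed by R(c) (x) N = N(c), that is x (x) y |-> f(x) y. *)
Definition contract_fun k p q (e : p + q = k) (x : M p) (y : N q) :
    N (c + k) :=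
  act (contract_eq e) (f p x : R (c + p)) y.

Lemma contract_balanced k : tens_balanced (@contract_fun k).
Proof.
split=> [p q e x x' y|p q e x y y'|a p q ap aq e1 e2 e3 e4 r x y].
- by rewrite /contract_fun hfunD; apply: actDl.
- exact: actDr.
- rewrite /contract_fun hfunZ /= /shift_act.
  (* Balancedness needs r f(x) = f(x) r, hence the commutativity of R. *)
  have e5 : (c + p) + a = c + ap by rewrite -e1 addrAC addrA.
  rewrite [X in act _ X y](grmulC (shift_eq c e1) e5).
  exact: actA.
Qed.

Definition contract k : tens M N k -> N (c + k) := tens_lift (@contract_fun k).

Lemma contract_mk k p q (e : p + q = k) (x : M p) (y : N q) :
  contract (tmk e x y) = act (contract_eq e) (f p x : R (c + p)) y.
Proof. exact: (tens_lift_mk (@contract_balanced k)). Qed.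

Lemma contractD k : {morph @contract k : x y / x + y}.
Proof. exact: (tens_liftD (@contract_balanced k)). Qed.

End Contraction.

Lemma contract_natural M N N' (u : grHom N N') c
    (f : grHom M (shift c (grself R))) k (z : tens M N k) :
  contract f (tmap u z) = u _ (contract f z).
Proof.
move: z; apply: tens_ext => [x y|x y|p q e x y].
- by rewrite tmapD contractD.
- by rewrite contractD hfunD.
- by rewrite tmap_mk !contract_mk hfunZ.
Qed.

(** Expand x in x (x) y by the dual basis and move each scalar f_t(x) across the tensor sign. *)
Lemma dual_basis_contract M (s : seq (dual_pair M)) N k (z : tens M N k) :
  is_dual_basis s ->
  z = \sum_(t <- s) tpure (projT2 t).1 (contract (projT2 t).2 z).
Proof.
move=> sE; move: z; apply: (@tens_ext _ _ _ _ id) => // [x y|p q e x y].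
  by rewrite -big_split; apply: eq_bigr => t _; rewrite contractD /tpure tmkDr.
rewrite [in LHS](sE _ x) tmk_suml; apply: eq_bigr => t _.
by rewrite contract_mk; apply: tmkZ.
Qed.

Section Evaluation.
Variables (M : grMod R) (g k l : G) (el : g + k = l).

Lemma evaluate_eq p q : p + q = k -> (g + q) + p = l.
Proof. by move=> e; rewrite -el -e addrAC addrA. Qed.

(** The canonical map M (x) R(g) -> M(g). The target degree is a variable l, so that the case k = 0
    lands in [M g] without transport. *)
Definition evaluate_fun p q (e : p + q = k) (x : M p)
    (r : shift g (grself R) q) : M l :=
  act (evaluate_eq e) (r : R (g + q)) x.

Lemma evaluate_balanced : tens_balanced evaluate_fun.
Proof.
split=> [p q e x x' y|p q e x y y'|a p q ap aq e1 e2 e3 e4 r x y].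
- exact: actDr.
- exact: actDl.
- rewrite /evaluate_fun /= /shift_act.
  have e5 : (g + q) + a = g + aq by rewrite -e2 addrAC addrA.
  rewrite [X in _ = act _ X x](grmulC (shift_eq g e2) e5).
  by symmetry; apply: actA.
Qed.

Definition evaluate : tens M (shift g (grself R)) k -> M l :=
  tens_lift evaluate_fun.

Lemma evaluate_mk p q (e : p + q = k) (x : M p) (r : shift g (grself R) q) :
  evaluate (tmk e x r) = act (evaluate_eq e) (r : R (g + q)) x.
Proof. exact: (tens_lift_mk evaluate_balanced). Qed.

Lemma evaluateD : {morph evaluate : x y / x + y}.
Proof. exact: (tens_liftD evaluate_balanced). Qed.

End Evaluation.
End TensElements.

(** * Limits and colimits *)

Section ColimElements.
Variables (G : zmodType) (R : grRing G) (J : smallCat) (Y : diagram R J).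

Lemma colim_sum g (z : colim Y g) :
  exists s : seq {j : J & Y j g},
    z = \sum_(t <- s) colim_in Y (projT1 t) g (projT2 t).
Proof.
elim/zpres_ind: z => [[j x]||z [s ->]|z z' [s ->] [s' ->]].
- by exists [:: existT (fun j => Y j g : Type) j x]; rewrite big_seq1.
- by exists [::]; rewrite big_nil.
- exists [seq existT (fun j => Y j g : Type) (projT1 t) (- projT2 t) | t <- s].
  by rewrite big_map -sumrN; apply: eq_bigr => t _; rewrite hfunN.
- by exists (s ++ s'); rewrite big_cat.
Qed.

Lemma colim_car_ext g (B : zmodType) (f f' : colim Y g -> B) :
  {morph f : x y / x + y} -> {morph f' : x y / x + y} ->
  (forall j x, f (colim_in Y j g x) = f' (colim_in Y j g x)) -> f =1 f'.
Proof. by move=> fD f'D ff'; apply: zpres_ext => // -[j x]; apply: ff'. Qed.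

End ColimElements.

Section ColimComparison.
Variables (G : zmodType) (R S : grRing G) (F : grFunctor R S) (J : smallCat)
  (X : diagram R J).

Lemma colim_comparison_in j g (x : F (X j) g) :
  colim_comparison F X g (colim_in (fdiagram F X) j g x) =
  fmap F (colim_in X j) g x.
Proof. exact: (colim_lift_in_fun (colim_comparison_subproof F X)). Qed.

(** A left inverse is only checked on generators and need not be linear: it serves injectivity
    alone. *)
Lemma colim_comparison_iso
    (inv : forall g, F (colim X) g -> colim (fdiagram F X) g) :
  (forall g, {morph inv g : x y / x + y}) ->
  (forall j g (x : F (X j) g),
    inv g (fmap F (colim_in X j) g x) = colim_in (fdiagram F X) j g x) ->
  gr_surjective (colim_comparison F X) ->
  is_iso (colim_comparison F X).
Proof.
move=> invD inv_in csurj; apply/is_isoP; split=> // g.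
apply: (can_inj (g := inv g)).
apply: (@colim_car_ext _ _ _ _ _ _
  (fun z => inv g (colim_comparison F X g z)) id).
- by move=> x y; rewrite hfunD invD.
- by [].
- by move=> j x; rewrite colim_comparison_in inv_in.
Qed.

End ColimComparison.

(** * Restriction and extension of scalars; limits under coextension *)

Section RestrictionExtension.
Variables (G : zmodType) (R S : grRing G) (h : grRingHom R S).

(** The generators and relations of a colimit in a given degree do not involve scalars, so the
    identity on generators is an inverse. *)
Lemma restriction_colim : commutes_with_inductive_limits (restriction h).
Proof.
move=> J X; have inD g j : {morph colim_in (fdiagram (restriction h) X) j g :
  x y / x + y} by apply: hfunD.
pose inv g :
    restriction h (colim X) g -> colim (fdiagram (restriction h) X) g :=
  @colim_car_lift _ _ _ X g (colim (fdiagram (restriction h) X) g)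
    (fun j => colim_in (fdiagram (restriction h) X) j g).
have inA g i j (k : arr i j) (x : X i g) :
    colim_in (fdiagram (restriction h) X) j g (darr X k g x) =
    colim_in (fdiagram (restriction h) X) i g x.
  exact: (colim_inA (X := fdiagram (restriction h) X)).
apply: (@colim_comparison_iso _ _ _ _ _ X inv) => [g|j g x|g].
- exact: (@colim_car_liftD _ _ _ X _ _ _ (inD g) (inA g)).
- exact: (@colim_car_lift_in _ _ _ X _ _ _ (inD g) (inA g)).
- elim/zpres_ind => [[j x]||_ [x <-]|_ _ [x <-] [y <-]].
  + by exists (colim_in (fdiagram (restriction h) X) j g x);
      rewrite colim_comparison_in.
  + by exists 0; rewrite hfun0.
  + by exists (- x); rewrite hfunN.
  + by exists (x + y); rewrite hfunD.
Qed.

Lemma restriction_lim : commutes_with_projective_limits (restriction h).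
Proof.
move=> J X; apply/is_isoP; split=> [g x y xy|g y].
  apply: lim_car_ext => j.
  exact: (congr1 (fun z : lim (fdiagram (restriction h) X) g => z j) xy).
exists (@LimCar _ _ _ X g (fun j => y j) (fun i j f => lim_compat y f)).
exact: lim_car_ext.
Qed.

(** A compatible family of maps T -> X_j(g) is the same as a map from T to the shifted limit. *)
Lemma coextension_lim : commutes_with_projective_limits (coextension h).
Proof.
move=> J X; apply/is_isoP; split=> [g u v uv|g z].
  apply: grHom_ext => k t; apply: lim_car_ext => j.
  exact: (congr1 (fun z : lim (fdiagram (coextension h) X) g => z j k t) uv).
have zA k (t : restrS h k) i j (f : arr i j) :
    darr X f (g + k) (z i k t) = z j k t.
  by rewrite -(lim_compat z f).
pose u k t : shift g (lim X) k := LimCar (@zA k t).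
have uD k t t' : u k (t + t') = u k t + u k t'.
  by apply: lim_car_ext => j; apply: (hfunD (z j)).
have uZ a b c (e : a + b = c) (r : R a) (t : restrS h b) :
    u c (act e r t) = act e r (u b t).
  by apply: lim_car_ext => j; apply: (hfunZ (z j)).
by exists (GrHom uD uZ); apply: lim_car_ext => j; apply: grHom_ext.
Qed.

Section ExtensionColim.
Variables (J : smallCat) (X : diagram R J).

(** The inverse comparison on pure tensors: s (x) [x] goes to [s (x) x]. *)
Definition ext_colim_inv_fun k p q (e : p + q = k) (s : restrS h p) :
    colim X q -> colim (fdiagram (extension h) X) k :=
  colim_car_lift
    (fun j x => colim_in (fdiagram (extension h) X) j k (tmk e s x)).

Let inD k p q (e : p + q = k) (s : restrS h p) j :
  {morph (fun x : X j q =>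
            colim_in (fdiagram (extension h) X) j k (tmk e s x)) : x y / x + y}.
Proof. by move=> x y; rewrite tmkDr hfunD. Qed.

Let inA k p q (e : p + q = k) (s : restrS h p) i j (f : arr i j) (x : X i q) :
  colim_in (fdiagram (extension h) X) j k (tmk e s (darr X f q x)) =
  colim_in (fdiagram (extension h) X) i k (tmk e s x).
Proof.
rewrite -[RHS](colim_inA (X := fdiagram (extension h) X) f) /=.
by rewrite tmap_mk.
Qed.

Lemma ext_colim_inv_fun_in k p q (e : p + q = k) (s : restrS h p) j
    (x : X j q) :
  ext_colim_inv_fun e s (colim_in X j q x) =
  colim_in (fdiagram (extension h) X) j k (tmk e s x).
Proof. exact: (colim_car_lift_in (inD e s) (inA e s)). Qed.

Lemma ext_colim_inv_funD k p q (e : p + q = k) (s : restrS h p) :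
  {morph ext_colim_inv_fun e s : x y / x + y}.
Proof. exact: (colim_car_liftD (inD e s) (inA e s)). Qed.

Lemma ext_colim_inv_balanced k : tens_balanced (@ext_colim_inv_fun k).
Proof.
split=> [p q e s s' y|p q e s y y'|a p q ap aq e1 e2 e3 e4 r s y].
- move: y; apply: colim_car_ext => [|x y|j x]; first exact: ext_colim_inv_funD.
    by rewrite !ext_colim_inv_funD addrACA.
  by rewrite !ext_colim_inv_fun_in tmkDl hfunD.
- exact: ext_colim_inv_funD.
- move: y; apply: colim_car_ext => [|x y|j x]; first exact: ext_colim_inv_funD.
    by rewrite actDr !ext_colim_inv_funD.
  by rewrite -hfunZ !ext_colim_inv_fun_in (tmkZ e1 e2 e3 e4).
Qed.

Lemma extension_colim : is_iso (colim_comparison (extension h) X).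
Proof.
pose inv k : extension h (colim X) k -> colim (fdiagram (extension h) X) k :=
  tens_lift (@ext_colim_inv_fun k).
have invD k : {morph inv k : x y / x + y}.
  exact: (tens_liftD (ext_colim_inv_balanced k)).
apply: (@colim_comparison_iso _ _ _ _ _ X inv) => // [j k x|k].
- move: x; apply: tens_ext => [x y|x y|p q e s x].
  + by rewrite hfunD invD.
  + exact: hfunD.
  + rewrite /= tmap_mk /inv (tens_lift_mk (ext_colim_inv_balanced k)).
    exact: ext_colim_inv_fun_in.
- elim/zpres_ind => [[p q e s x]||_ [x <-]|_ _ [x <-] [y <-]].
  + rewrite -/(tmk e s x).
    elim/zpres_ind: x => [[j x]||x [z zE]|x y [z zE] [z' z'E]].
    * exists (colim_in (fdiagram (extension h) X) j k (tmk e s x)).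
      by rewrite colim_comparison_in /= tmap_mk.
    * by exists 0; rewrite hfun0 tmk0r.
    * by exists (- z); rewrite hfunN zE tmkNr.
    * by exists (z + z'); rewrite hfunD zE z'E tmkDr.
  + by exists 0; rewrite hfun0.
  + by exists (- x); rewrite hfunN.
  + by exists (x + y); rewrite hfunD.
Qed.

End ExtensionColim.

(** Both functors have the same components and the same maps [tmap], and exactness sees nothing
    else. *)
Lemma extension_exactP : exact_functor (extension h) <-> flat (restrS h).
Proof. by split=> H M N P u v uv; apply: (H M N P u v uv). Qed.

(** By naturality of [contract], the coordinates of a compatible family of tensors are compatible
    families, that is elements of the limit. *)
Lemma dual_basis_extension_lim :
  dual_basis (restrS h) -> commutes_with_projective_limits (extension h).
Proof.
move=> [s sE] J X; apply/is_isoP; split=> [k z z' zz'|k z].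
  rewrite (dual_basis_contract z sE) (dual_basis_contract z' sE).
  apply: eq_bigr => t _; congr tpure; apply: lim_car_ext => j.
  rewrite -[LHS]/(lim_proj X j _ _) -[RHS]/(lim_proj X j _ _).
  rewrite -!contract_natural; congr contract.
  exact: (congr1 (fun y : lim (fdiagram (extension h) X) k => y j) zz').
have nA (t : dual_pair (restrS h)) i j (f : arr i j) :
    darr X f _ (contract (projT2 t).2 (z i)) = contract (projT2 t).2 (z j).
  by rewrite -(lim_compat z f) -contract_natural.
pose n t : lim X (projT1 t + k) := LimCar (nA t).
exists (\sum_(t <- s) tpure (projT2 t).1 (n t)); apply: lim_car_ext => j /=.
rewrite tmap_sum [RHS](dual_basis_contract (z j) sE).
by apply: eq_bigr => t _; rewrite tmap_tpure.
Qed.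

End RestrictionExtension.

(** * From commutation with limits to a dual basis *)

Section TmapAdd.
Variables (G : zmodType) (R : grRing G).
Implicit Types M N P : grMod R.

Lemma tmap0 M N N' k (z : tens M N k) : tmap (0 : grHom N N') z = 0.
Proof.
move: z; apply: (@tens_ext _ _ _ _ _ _ _ (fun=> 0)).
- exact: tmapD.
- by move=> x y; rewrite addr0.
- by move=> p q e x y; rewrite tmap_mk tmk0r.
Qed.

Lemma tmap_addl M N N' (u v : grHom N N') k (z : tens M N k) :
  tmap (u + v) z = tmap u z + tmap v z.
Proof.
move: z; apply: tens_ext => [||p q e x y].
- exact: tmapD.
- by move=> x y; rewrite !tmapD addrACA.
- by rewrite !tmap_mk tmkDr.
Qed.

End TmapAdd.

Section Pairs.
Variables (G : zmodType) (R : grRing G).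
Implicit Types M N P : grMod R.

(** Pairs rather than single copies of R(c): additivity will be tested inside one object that holds
    two elements. As a product over [bool], its coordinates are read by application. *)
Definition pair_mod (c : G) : grMod R :=
  gprod (fun _ : bool => shift c (grself R)).

Definition pair_in (c : G) (b : bool) :
    grHom (shift c (grself R)) (pair_mod c) :=
  gprod_lift (fun b' => if b' == b then hid _ else 0).

Definition pair_pr (c : G) (b : bool) :
    grHom (pair_mod c) (shift c (grself R)) :=
  gprod_proj (fun _ : bool => shift c (grself R)) b.

Lemma pair_pr_in c b : hcomp (pair_pr c b) (pair_in c b) = hid _.
Proof. by apply: grHom_ext => g x /=; rewrite /gprod_lift_fun eqxx. Qed.

Lemma pair_pr_in_neq c b : hcomp (pair_pr c b) (pair_in c (~~ b)) = 0.
Proof.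
by apply: grHom_ext => g x /=; rewrite /gprod_lift_fun; case: b.
Qed.

Lemma gcast_grmul a b c a' b' c' (e : a + b = c) (e' : a' + b' = c')
    (ea : a = a') (eb : b = b') (ec : c = c') (r : R a) (s : R b) :
  grmul e' (gcast ea r) (gcast eb s) = gcast (C := R) ec (grmul e r s).
Proof.
case: a' / ea e' => e'; case: b' / eb e' => e'; case: c' / ec e' => e' /=.
by rewrite (Prop_irrelevance e e').
Qed.

Lemma shift_scalar_eq (a g g' : G) : a + g = g' -> a = g' - g.
Proof. by move=> <-; rewrite addrK. Qed.

Definition shift_scalar a g g' (e : a + g = g') (r : R a) :
    grHom (shift g (grself R)) (shift g' (grself R)) :=
  free_hom (M := shift g' (grself R))
    (gcast (C := R) (shift_scalar_eq e) r : shift g' (grself R) (- g)).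

Section LimDualBasis.
Variable M : grMod R.

(* The category of elements of M (x) -, restricted to the modules R(g)^2:    *)
(* its objects stand for the elements x (x) e_true + y (x) e_false.          *)
Definition elt_ob : Type := {g : G & (M g * M g)%type}.

Definition elt_mod (o : elt_ob) : grMod R := pair_mod (projT1 o).

(** The tensor x (x) 1, which corresponds to x under M (x) R(g) = M(g); its degree is 0 because 1
    has degree - g in R(g). *)
Definition unit_tens g (x : M g) : tens M (shift g (grself R)) 0 :=
  tmk (subrr g) x (unit_shift R g).

Definition elt_tens (o : elt_ob) : tens M (elt_mod o) 0 :=
  tmap (pair_in (projT1 o) true) (unit_tens (projT2 o).1) +
  tmap (pair_in (projT1 o) false) (unit_tens (projT2 o).2).

Definition elt_arr (i j : elt_ob) : Type :=
  {u : grHom (elt_mod i) (elt_mod j) | tmap u (elt_tens i) = elt_tens j}.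

Lemma elt_arr_ext i j (u v : elt_arr i j) : projT1 u = projT1 v -> u = v.
Proof.
case: u v => [u uP] [v vP] /= uv; case: v / uv vP => vP.
by rewrite (Prop_irrelevance uP vP).
Qed.

Definition elt_id i : elt_arr i i :=
  exist _ (hid (elt_mod i)) (tmap_id (elt_tens i)).

Definition elt_comp i j k (u : elt_arr i j) (v : elt_arr j k) : elt_arr i k.
Proof.
exists (hcomp (projT1 v) (projT1 u)).
by rewrite tmap_comp (projT2 u) (projT2 v).
Defined.

Definition elt_cat : smallCat.
Proof.
exists elt_ob elt_arr elt_id elt_comp.
- by move=> i j u; apply: elt_arr_ext; apply: grHom_ext.
- by move=> i j u; apply: elt_arr_ext; apply: grHom_ext.
- by move=> i j k l u v w; apply: elt_arr_ext; apply: grHom_ext.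
Defined.

Definition elt_diagram : diagram R elt_cat.
Proof. by exists elt_mod (fun i j (u : elt_arr i j) => projT1 u). Defined.

Lemma unit_tensD g (x y : M g) : unit_tens (x + y) = unit_tens x + unit_tens y.
Proof. exact: tmkDl. Qed.

Lemma unit_tens0 g : unit_tens (0 : M g) = 0.
Proof. exact: tmk0l. Qed.

Lemma elt_tens_pr1 o :
  tmap (pair_pr (projT1 o) true) (elt_tens o) = unit_tens (projT2 o).1.
Proof.
rewrite /elt_tens tmapD -!tmap_comp (pair_pr_in_neq _ true) tmap0 addr0.
by rewrite pair_pr_in tmap_id.
Qed.

Lemma elt_tens_pr2 o :
  tmap (pair_pr (projT1 o) false) (elt_tens o) = unit_tens (projT2 o).2.
Proof.
rewrite /elt_tens tmapD -!tmap_comp (pair_pr_in_neq _ false) tmap0 add0r.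
by rewrite pair_pr_in tmap_id.
Qed.

Lemma unit_tensZ a g g' (e : a + g = g') (r : R a) (x : M g) :
  tmap (shift_scalar e r) (unit_tens x) = unit_tens (act e r x).
Proof.
have e2 : a + - g' = - g by rewrite -e opprD addNKr.
rewrite /unit_tens tmap_mk free_hom1 (tmkZ e e2 _ (subrr g)).
by rewrite (act_unit_shift _ (shift_scalar_eq e)).
Qed.

Definition elt1 g (x : M g) : elt_ob :=
  existT (fun g => (M g * M g)%type) g (x, 0).
Definition elt2 g (x y : M g) : elt_ob :=
  existT (fun g => (M g * M g)%type) g (x, y).

Section FormOfLim.
Variables (c : G) (n : lim elt_diagram (c + 0)).

(** Followed by the first inclusion, v is an arrow from o to the object (x, 0), so compatibility of
    n applies. Additivity and linearity of the form both come from suitable choices of o and v. *)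
Lemma lim_elt1 (o : elt_ob) g (x : M g)
    (v : grHom (elt_mod o) (shift g (grself R))) :
  tmap v (elt_tens o) = unit_tens x -> n (elt1 x) true = v _ (n o).
Proof.
move=> vx.
have uP : tmap (hcomp (pair_in g true) v) (elt_tens o) = elt_tens (elt1 x).
  rewrite tmap_comp vx /elt_tens /= unit_tens0.
  by rewrite (morph_add0 (@tmapD _ _ _ _ _ _ _)) addr0.
have := lim_compat n (exist _ _ uP : @arr elt_cat o (elt1 x)).
by move=> /(congr1 (fun y : elt_mod (elt1 x) _ => y true)) <-.
Qed.

Lemma lim_form_eq g : g + (c + 0) = c + g.
Proof. by rewrite addr0 addrC. Qed.

(** The form attached to n: its value at x is the first coordinate of n at (x, 0). *)
Definition lim_form_fun g (x : M g) : shift c (grself R) g :=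
  gcast (C := R) (lim_form_eq g) (n (elt1 x) true : R _).

Lemma lim_form_add g (x y : M g) :
  lim_form_fun (x + y) = lim_form_fun x + lim_form_fun y.
Proof.
rewrite -[RHS](gcastD (C := R) (lim_form_eq g)).
rewrite /lim_form_fun.
suff -> : n (elt1 (x + y)) true = n (elt1 x) true + n (elt1 y) true by [].
(* The three values at x, y and x + y are all read off at the object (x, y), by the two projections
   and their sum. *)
rewrite (@lim_elt1 (elt2 x y) _ _ (pair_pr g true + pair_pr g false)).
  rewrite (@lim_elt1 (elt2 x y) _ _ (pair_pr g true)).
    rewrite (@lim_elt1 (elt2 x y) _ _ (pair_pr g false)) //.
    exact: (elt_tens_pr2 (elt2 x y)).
  exact: (elt_tens_pr1 (elt2 x y)).
rewrite tmap_addl (elt_tens_pr1 (elt2 x y)) (elt_tens_pr2 (elt2 x y)).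
by rewrite unit_tensD.
Qed.

Lemma lim_form_scale a b d (e : a + b = d) (r : R a) (x : M b) :
  lim_form_fun (act e r x) = act e r (lim_form_fun x).
Proof.
pose y : R (b + (c + 0)) := n (elt1 x) true.
have e2 : (b + (c + 0)) + a = d + (c + 0) by rewrite addrAC (addrC b) e.
have e3 : (c + b) + a = c + d by rewrite -addrA (addrC b) e.
transitivity (gcast (C := R) (lim_form_eq d) (grmul e2 y r)).
  rewrite /lim_form_fun.
  suff -> : n (elt1 (act e r x)) true = grmul e2 y r by [].
  rewrite (@lim_elt1 (elt1 x) _ _ (hcomp (shift_scalar e r) (pair_pr b true))).
    exact: (gcast_grmul e2 _ erefl (shift_scalar_eq e) erefl).
  rewrite tmap_comp (elt_tens_pr1 (elt1 x)); exact: unit_tensZ.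
rewrite -[RHS]/(grmul (shift_eq c e) r (lim_form_fun x)) (grmulC _ e3).
by symmetry; apply: (gcast_grmul e2 e3 (lim_form_eq b) erefl).
Qed.

Definition lim_form : grHom M (shift c (grself R)) :=
  GrHom lim_form_add lim_form_scale.

End FormOfLim.

(** The tautological family [elt_tens] is compatible by the definition of the arrows; a preimage sum
    m_t (x) n_t yields the elements m_t and the forms of the n_t. *)
Lemma lim_surjective_dual_basis :
  (forall (J : smallCat) (X : diagram R J) (y : forall j, tens M (X j) 0),
    (forall i j (f : arr i j), tmap (darr X f) (y i) = y j) ->
    exists z : tens M (lim X) 0, forall j, tmap (lim_proj X j) z = y j) ->
  dual_basis M.
Proof.
move=> /(_ elt_cat elt_diagram elt_tens) [i j f|z zE]; first exact: (projT2 f).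
have [s sE] := tens_sum z.
exists [seq existT (fun c => (M (- c) * grHom M (shift c (grself R)))%type)
          (projT1 t) ((projT2 t).1, lim_form (projT2 t).2) | t <- s].
move=> g x; rewrite big_map /=.
(* At (x, 0), the first coordinate of the family is x (x) 1; evaluation turns the equality of
   tensors into x = sum f_t(x) m_t. *)
have := congr1 (@tmap _ _ _ _ _ (pair_pr g true) 0) (zE (elt1 x)).
rewrite (elt_tens_pr1 (elt1 x)) sE !tmap_sum.
move=> /(congr1 (evaluate (addr0 g))).
rewrite evaluate_mk (act_one_cast _ _ erefl) => /= xE.
rewrite -[LHS]xE (morph_add_sum _ _ _ (@evaluateD _ _ _ _ _ _ _)).
apply: eq_bigr => t _; rewrite !tmap_tpure evaluate_mk /=.
by rewrite /free_hom_fun /lim_form_fun; symmetry; apply: act_castl.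
Qed.

End LimDualBasis.
End Pairs.

Lemma extension_lim_dual_basis (G : zmodType) (R S : grRing G)
    (h : grRingHom R S) :
  commutes_with_projective_limits (extension h) -> dual_basis (restrS h).
Proof.
move=> H; apply: lim_surjective_dual_basis => J X y yP.
have /is_isoP [_ /(_ 0)] := H J X.
move=> /(_ (@LimCar _ _ _ (fdiagram (extension h) X) 0 y yP)) [z zE].
exists z => j.
exact: (congr1 (fun y : lim (fdiagram (extension h) X) 0 => y j) zE).
Qed.

Section Compose.
Variables (G : zmodType) (R : grRing G).
Implicit Types M N P : grMod R.

Lemma hcompA M N P Q (w : grHom P Q) (v : grHom N P) (u : grHom M N) :
  hcomp w (hcomp v u) = hcomp (hcomp w v) u.
Proof. exact: grHom_ext. Qed.

Lemma hcomp0 M N P (v : grHom N P) : hcomp v (0 : grHom M N) = 0.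
Proof. by apply: grHom_ext => g x; apply: hfun0. Qed.

Lemma hcomp1l M N (u : grHom M N) : hcomp (hid N) u = u.
Proof. exact: grHom_ext. Qed.

Lemma shift0_in_inj M N :
  injective (fun u : grHom M N => hcomp (shift0_in N) u).
Proof.
move=> u v /(congr1 (hcomp (shift0_out N))).
by rewrite !hcompA shift0_inK !hcomp1l.
Qed.

End Compose.

(** * Coextension *)

Section CoextensionExact.
Variables (G : zmodType) (R S : grRing G) (h : grRingHom R S).

(** Shifts preserve exactness, so projectivity gives every degree; conversely degree 0 is plain Hom
    up to the natural isomorphism with M(0). *)
Lemma coextension_exactP :
  exact_functor (coextension h) <-> projective (restrS h).
Proof.
split=> [H N' N N'' u v uv y|H N' N N'' u v uv g]; last first.
  apply: (H _ _ _ (shift_hom g u) (shift_hom g v)) => k; exact: uv.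
split=> [vy|[x <-]]; last first.
  apply: grHom_ext => g x0 /=.
  by apply/(uv g); exists (x g x0).
have [x xE] : exists x, hcomp (shift_hom 0 u) x = hcomp (shift0_in N) y.
  apply/(H _ _ _ u v uv 0); rewrite -[LHS]/(hcomp (shift_hom 0 v) _).
  by rewrite hcompA -shift0_in_natural -hcompA vy hcomp0.
exists (hcomp (shift0_out N') x).
by rewrite hcompA -shift0_out_natural -hcompA xE hcompA shift0_inK hcomp1l.
Qed.

End CoextensionExact.

(** * Coextension, direct sums and smallness *)

Section ZsumMap.
Variables (J : Type) (A B : J -> zmodType) (f : forall j, A j -> B j).
Hypothesis fD : forall j, {morph @f j : x y / x + y}.

Definition zsum_map : zsum A -> zsum B :=
  zsum_lift (fun j x => zsum_in (f x)).

Let inD j : {morph (fun x : A j => zsum_in (f x)) : x y / x + y}.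
Proof. by move=> x y; rewrite fD zsum_inD. Qed.

Lemma zsum_map_in j (x : A j) : zsum_map (zsum_in x) = zsum_in (f x).
Proof. exact: (zsum_lift_in inD). Qed.

Lemma zsum_mapD : {morph zsum_map : x y / x + y}.
Proof. exact: (zsum_liftD inD). Qed.

End ZsumMap.

Lemma zsum_ext (J : Type) (A : J -> zmodType) (B : zmodType)
    (f f' : zsum A -> B) :
  {morph f : x y / x + y} -> {morph f' : x y / x + y} ->
  (forall j (x : A j), f (zsum_in x) = f' (zsum_in x)) -> f =1 f'.
Proof. by move=> fD f'D ff'; apply: zpres_ext => // -[j x]; apply: ff'. Qed.

Section CoextensionSum.
Variables (G : zmodType) (R S : grRing G) (h : grRingHom R S).
Let T : grMod R := restrS h.

Lemma small_comparisonD (J : Type) (N : J -> grMod R) :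
  {morph @small_comparison _ _ T J N : x y / x + y}.
Proof.
apply: (@zsum_liftD _ (fun j => grHom T (N j) : zmodType)) => j u v.
exact: hcompDr.
Qed.

Lemma small_comparison_in (J : Type) (N : J -> grMod R) j (u : grHom T (N j)) :
  small_comparison (@zsum_in _ (fun j => grHom T (N j) : zmodType) j u) =
  hcomp (gsum_in N j) u.
Proof.
apply: (@zsum_lift_in _ (fun j => grHom T (N j) : zmodType)) => {u}j u v.
exact: hcompDr.
Qed.

Section Family.
Variables (J : Type) (N : J -> grMod R) (g : G).

(** Direct sums are formed degreewise, so shifting commutes with them and the comparison is the
    identity on components. *)
Definition gsum_shift_out :
    grHom (gsum (fun j => shift g (N j))) (shift g (gsum N)) :=
  @GrHom _ R (gsum (fun j => shift g (N j))) (shift g (gsum N))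
    (fun k x => x) (fun k x y => erefl) (fun a b c e r x => erefl).

Definition gsum_shift_in :
    grHom (shift g (gsum N)) (gsum (fun j => shift g (N j))) :=
  @GrHom _ R (shift g (gsum N)) (gsum (fun j => shift g (N j)))
    (fun k x => x) (fun k x y => erefl) (fun a b c e r x => erefl).

Lemma sum_comparison_in j (u : coext_mod h (N j) g) :
  sum_comparison (coextension h) N g
    (gsum_in (fun j => coext_mod h (N j)) j g u) =
  hcomp (shift_hom g (gsum_in N j)) u :> coext_mod h (gsum N) g.
Proof.
exact: (gsum_lift_in_fun (fun j => fmap (coextension h) (gsum_in N j))).
Qed.

Lemma sum_comparisonE (z : gsum (fun j => coext_mod h (N j)) g) :
  sum_comparison (coextension h) N g z =
  hcomp gsum_shift_out
    (@small_comparison _ _ T J (fun j => shift g (N j)) z).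
Proof.
move: z; apply: (@zsum_ext _ (fun j => coext_mod h (N j) g)) => [x y|x y|j u].
- exact: hfunD.
- by rewrite small_comparisonD hcompDr.
- rewrite [LHS]sum_comparison_in [in RHS]small_comparison_in.
  exact: grHom_ext.
Qed.

End Family.

Lemma small_comparison_shift0 (J : Type) (N : J -> grMod R)
    (z : zsum (fun j => grHom T (N j) : zmodType)) :
  hcomp (shift0_in (gsum N)) (small_comparison z) =
  sum_comparison (coextension h) N 0
    (@zsum_map J (fun j => grHom T (N j) : zmodType)
      (fun j => coext_mod h (N j) 0) (fun j => hcomp (shift0_in (N j))) z).
Proof.
have inD j : {morph (hcomp (shift0_in (N j)) : grHom T (N j) -> _) :
    x y / x + y} by apply: hcompDr.
move: z.
apply: (@zsum_ext _ (fun j => grHom T (N j) : zmodType)) => [x y|x y|j u].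
- by rewrite small_comparisonD hcompDr.
- by rewrite zsum_mapD // hfunD.
- rewrite zsum_map_in // small_comparison_in [RHS]sum_comparison_in.
  by rewrite !hcompA shift0_in_natural.
Qed.

(** Smallness is commutation in degree 0; commutation in degree g is smallness tested on the shifted
    family N_j(g). *)
Lemma coextension_sumP : commutes_with_sums (coextension h) <-> small T.
Proof.
split=> [H J N|H J N]; last first.
  apply/is_isoP; split=> [g z z'|g u].
    rewrite !sum_comparisonE => zz'.
    apply: (bij_inj (H J (fun j => shift g (N j)))).
    apply: grHom_ext => k t.
    exact: (congr1 (fun w : grHom T (shift g (gsum N)) => w k t) zz').
  have [inv _ invK] := H J (fun j => shift g (N j)).
  exists (inv (hcomp (gsum_shift_in N g) u)).
  by rewrite sum_comparisonE invK; apply: grHom_ext.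
have /is_isoP [cinj csurj] := H J N.
pose A j : zmodType := grHom T (N j).
pose B j : zmodType := coext_mod h (N j) 0.
pose a j : A j -> B j := hcomp (shift0_in (N j)).
pose b j : B j -> A j := hcomp (shift0_out (N j)).
have aD j : {morph a j : x y / x + y} by apply: hcompDr.
have bD j : {morph b j : x y / x + y} by apply: hcompDr.
have aK : cancel (zsum_map a) (zsum_map b).
  apply: (@zsum_ext _ _ _ (fun x => zsum_map b (zsum_map a x)) id) => //
    [x y|j x].
    by rewrite !zsum_mapD.
  by rewrite !zsum_map_in // /a /b hcompA shift0_inK hcomp1l.
have bK : cancel (zsum_map b) (zsum_map a).
  apply: (@zsum_ext _ _ _ (fun x => zsum_map a (zsum_map b x)) id) => //
    [x y|j x].
    by rewrite !zsum_mapD.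
  by rewrite !zsum_map_in // /a /b hcompA shift0_outK hcomp1l.
have sinj : injective (@small_comparison _ _ T J N).
  move=> z z' /(congr1 (hcomp (shift0_in (gsum N)))).
  by rewrite !small_comparison_shift0 => /cinj /(can_inj aK).
have ssurj u : exists z, @small_comparison _ _ T J N z = u.
  have [w wE] := csurj 0 (hcomp (shift0_in (gsum N)) u).
  exists (zsum_map b w); apply: (@shift0_in_inj _ _ T).
  by rewrite small_comparison_shift0 -wE -[in RHS](bK w).
pose inv u := projT1 (cid (ssurj u)).
have invK : cancel inv (@small_comparison _ _ T J N).
  by move=> u; rewrite /inv; case: cid.
by exists inv => // z; apply: sinj; rewrite invK.
Qed.

End CoextensionSum.

(** * A module as a retract of a colimit of modules R(c)^2 *)

Section CanonicalColim.
Variables (G : zmodType) (R : grRing G) (M : grMod R).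

(** An object (c, x, y) encodes the map R(c)^2 -> M sending the two generators, of degree - c, to x
    and y. *)
Definition over_ob : Type := {c : G & (M (- c) * M (- c))%type}.

Definition over_mod (o : over_ob) : grMod R := pair_mod R (projT1 o).

Definition over_hom (o : over_ob) : grHom (over_mod o) M :=
  hcomp (free_hom (projT2 o).1) (pair_pr R (projT1 o) true) +
  hcomp (free_hom (projT2 o).2) (pair_pr R (projT1 o) false).

Definition over_arr (i j : over_ob) : Type :=
  {u : grHom (over_mod i) (over_mod j) | hcomp (over_hom j) u = over_hom i}.

Lemma over_arr_ext i j (u v : over_arr i j) : projT1 u = projT1 v -> u = v.
Proof.
case: u v => [u uP] [v vP] /= uv; case: v / uv vP => vP.
by rewrite (Prop_irrelevance uP vP).
Qed.

Definition over_id i : over_arr i i.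
Proof. by exists (hid (over_mod i)); apply: grHom_ext. Defined.

Definition over_comp i j k (u : over_arr i j) (v : over_arr j k) : over_arr i k.
Proof.
exists (hcomp (projT1 v) (projT1 u)).
by rewrite hcompA (projT2 v) (projT2 u).
Defined.

Definition over_cat : smallCat.
Proof.
exists over_ob over_arr over_id over_comp.
- by move=> i j u; apply: over_arr_ext; apply: grHom_ext.
- by move=> i j u; apply: over_arr_ext; apply: grHom_ext.
- by move=> i j k l u v w; apply: over_arr_ext; apply: grHom_ext.
Defined.

Definition over_diagram : diagram R over_cat.
Proof. by exists over_mod (fun i j (u : over_arr i j) => projT1 u). Defined.

Definition over_colim_hom : grHom (colim over_diagram) M :=
  @colim_lift _ _ _ over_diagram M over_hom (fun i j k => projT2 k).

Lemma over_colim_hom_in (o : over_ob) g x :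
  over_colim_hom g (colim_in over_diagram o g x) = over_hom o g x.
Proof.
exact: (@colim_lift_in_fun _ _ _ over_diagram M over_hom
  (fun i j k => projT2 k)).
Qed.

Definition over1 c (x : M (- c)) : over_ob :=
  existT (fun c => (M (- c) * M (- c))%type) c (x, 0).

Definition over2 c (x y : M (- c)) : over_ob :=
  existT (fun c => (M (- c) * M (- c))%type) c (x, y).

Definition over_unit (o : over_ob) (b : bool) : over_mod o (- projT1 o) :=
  pair_in R (projT1 o) b _ (unit_shift R (projT1 o)).

Lemma over_homE (o : over_ob) g (w : over_mod o g) :
  over_hom o g w =
  free_hom (projT2 o).1 g (w true) + free_hom (projT2 o).2 g (w false).
Proof. by []. Qed.

Lemma free_hom0m (N : grMod R) c g (r : shift c (grself R) g) :
  free_hom (0 : N (- c)) g r = 0.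
Proof. exact: act0. Qed.

Lemma over_hom_unit1 (o : over_ob) :
  over_hom o _ (over_unit o true) = (projT2 o).1.
Proof.
rewrite over_homE; have -> : over_unit o true false = 0 by [].
by rewrite hfun0 addr0; apply: free_hom1.
Qed.

Lemma over_hom_unit2 (o : over_ob) :
  over_hom o _ (over_unit o false) = (projT2 o).2.
Proof.
rewrite over_homE; have -> : over_unit o false true = 0 by [].
by rewrite hfun0 add0r; apply: free_hom1.
Qed.

Definition over_section_at c (x : M (- c)) : colim over_diagram (- c) :=
  colim_in over_diagram (over1 x) _ (over_unit (over1 x) true).

(* For o = (x, y), resp. (x, 0), this makes the section additive, resp.       *)
(* linear.                                                                    *)
Lemma over_section_atE (o : over_ob) c (x : M (- c)) (w : over_mod o (- c)) :
  over_hom o _ w = x -> over_section_at x = colim_in over_diagram o _ w.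
Proof.
move=> wx.
(* This map sends the first generator to w and kills the second; it lies over M because the second
   generator of (x, 0) maps to 0. *)
pose u : grHom (over_mod (over1 x)) (over_mod o) :=
  hcomp (free_hom w) (pair_pr R c true).
have uP : hcomp (over_hom o) u = over_hom (over1 x).
  apply: grHom_ext => g z.
  rewrite over_homE [X in _ + X]free_hom0m addr0.
  by rewrite /u [LHS](free_hom_hcomp (over_hom o) w) wx.
pose f : @arr over_cat (over1 x) o := exist _ _ uP.
rewrite /over_section_at -[LHS](colim_inA (X := over_diagram) f).
congr (colim_in over_diagram o _ _).
exact: (free_hom1 w).
Qed.

Lemma over_section_atD c : {morph @over_section_at c : x y / x + y}.
Proof.
move=> x y; pose o := over2 x y.
rewrite (@over_section_atE o _ x (over_unit o true)) ?over_hom_unit1 //.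
rewrite (@over_section_atE o _ y (over_unit o false)) ?over_hom_unit2 //.
rewrite -hfunD; apply: over_section_atE.
by rewrite hfunD over_hom_unit1 over_hom_unit2.
Qed.

Lemma over_section_atZ a b c (e : a + - b = - c) (r : R a) (x : M (- b)) :
  over_section_at (act e r x) = act e r (over_section_at x).
Proof.
rewrite {2}/over_section_at -hfunZ; apply: over_section_atE.
by rewrite hfunZ over_hom_unit1.
Qed.

(** Generators live in degrees written [- c], so a general degree g is treated as [- - g]. *)
Definition over_section_fun g (x : M g) : colim over_diagram g :=
  gcast (C := colim over_diagram) (opprK g)
    (over_section_at (gcast (C := M) (esym (opprK g)) x)).

Lemma over_section_add g (x y : M g) :
  over_section_fun (x + y) = over_section_fun x + over_section_fun y.
Proof.
by rewrite /over_section_fun gcastD over_section_atD (@gcastD _ (colim _)).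
Qed.

Lemma over_section_scale a b c (e : a + b = c) (r : R a) (x : M b) :
  over_section_fun (act e r x) = act e r (over_section_fun x).
Proof.
have e' : a + - - b = - - c by rewrite !opprK.
rewrite /over_section_fun (gcast_act e e' (esym (opprK b))) over_section_atZ.
exact: gcast_act.
Qed.

Definition over_section : grHom M (colim over_diagram) :=
  GrHom over_section_add over_section_scale.

Lemma over_sectionK g (x : M g) : over_colim_hom g (over_section g x) = x.
Proof.
rewrite /= /over_section_fun -[LHS]/(over_colim_hom g _).
rewrite (gcast_hom over_colim_hom) over_colim_hom_in over_hom_unit1 /=.
by rewrite (gcast_comp _ _ (erefl g)).
Qed.

(** Composing with the retraction writes the identity as a finite sum of maps M -> R(c)^2 -> M; each
    of them contributes two dual pairs. *)
Lemma over_section_dual_basis (s : seq {o : over_ob & grHom M (over_mod o)}) :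
  over_section =
    \sum_(t <- s) hcomp (colim_in over_diagram (projT1 t)) (projT2 t) ->
  dual_basis M.
Proof.
move=> sE.
pose el (t : {o : over_ob & grHom M (over_mod o)}) (b : bool) : dual_pair M :=
  existT (fun c => (M (- c) * grHom M (shift c (grself R)))%type)
    (projT1 (projT1 t))
    (if b then (projT2 (projT1 t)).1 else (projT2 (projT1 t)).2,
     hcomp (pair_pr R _ b) (projT2 t)).
exists ([seq el t true | t <- s] ++ [seq el t false | t <- s]) => g x.
rewrite -[LHS]over_sectionK sE sum_grHomE hfun_sum big_cat !big_map /=.
rewrite -big_split.
by apply: eq_bigr => t _; rewrite [LHS]over_colim_hom_in over_homE.
Qed.

End CanonicalColim.

(** * Coextension and inductive limits *)

Section CoextensionColim.
Variables (G : zmodType) (R S : grRing G) (h : grRingHom R S).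
Let T : grMod R := restrS h.

(** A preimage of the section under the degree 0 comparison is a finite sum of classes, so the
    section factors as [over_section_dual_basis] requires. *)
Lemma coextension_colim_dual_basis :
  commutes_with_inductive_limits (coextension h) -> dual_basis T.
Proof.
move=> H; have /is_isoP [_ csurj] := H _ (over_diagram T).
have [w wE] := csurj 0 (hcomp (shift0_in _) (over_section T)).
have [s sE] := colim_sum w.
pose v (t : {j : over_cat T & fdiagram (coextension h) (over_diagram T) j 0}) :
    {o : over_ob T & grHom T (over_mod o)} :=
  existT (fun o => grHom T (over_mod o)) (projT1 t)
    (hcomp (shift0_out (over_mod (projT1 t))) (projT2 t)).
apply: (@over_section_dual_basis _ _ T [seq v t | t <- s]).
apply: shift0_in_inj; rewrite -[LHS]wE sE hfun_sum big_map.
rewrite (@morph_add_sum _ _ (hcomp (shift0_in _))); last exact: hcompDr.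
apply: eq_bigr => t _; rewrite colim_comparison_in.
rewrite !hcompA shift0_in_natural -[X in hcomp X _]hcompA shift0_outK.
exact: grHom_ext.
Qed.

Lemma dual_basis_coextension_colim :
  dual_basis T -> commutes_with_inductive_limits (coextension h).
Proof.
move=> [s sE] J X.
pose Y := fdiagram (coextension h) X.
(* The rank one map x |-> f_t(x) n. Every u is the sum of those with n = u(m_t), naturally in N. *)
pose rk1 (t : dual_pair T) g (N : grMod R) (n : N (g + - projT1 t)) :
    grHom T (shift g N) :=
  hcomp (free_hom (M := shift g N) (n : shift g N (- projT1 t))) (projT2 t).2.
have rk1D t g N : {morph @rk1 t g N : x y / x + y}.
  by move=> x y; apply: grHom_ext => k z; apply: actDr.
have rk1_hom t g N N' (u : grHom N N') n :
    hcomp (shift_hom g u) (@rk1 t g N n) = rk1 t g N' (u _ n).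
  apply: grHom_ext => k z.
  exact: (free_hom_hcomp (shift_hom g u) (n : shift g N (- projT1 t))).
have rk1E g N (u : grHom T (shift g N)) :
    u = \sum_(t <- s) rk1 t g N (u _ (projT2 t).1).
  apply: grHom_ext => k z; rewrite sum_grHomE [in LHS](sE _ z) hfun_sum.
  by apply: eq_bigr => t _; apply: (free_hom_hcomp u).
pose psi_in t g j (n : X j (g + - projT1 t)) : colim Y g :=
  colim_in Y j g (rk1 t g (X j) n : Y j g).
have psi_inD t g j : {morph @psi_in t g j : x y / x + y}.
  by move=> x y; rewrite /psi_in rk1D hfunD.
have psi_inA t g i j (f : arr i j) (n : X i (g + - projT1 t)) :
    psi_in t g j (darr X f _ n) = psi_in t g i n.
  by rewrite /psi_in -rk1_hom; apply: (colim_inA (X := Y) f).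
(* Naturality of rank one maps lets n |-> [f_t n] descend to the colimit; summing over t at u(m_t)
   inverts the comparison. *)
pose psi t g : colim X (g + - projT1 t) -> colim Y g :=
  colim_car_lift (psi_in t g).
have psiD t g : {morph psi t g : x y / x + y}.
  exact: (colim_car_liftD (psi_inD t g) (psi_inA t g)).
have psi_colim t g j n : psi t g (colim_in X j _ n) = psi_in t g j n.
  exact: (colim_car_lift_in (psi_inD t g) (psi_inA t g)).
have psi_comp t g (n : colim X (g + - projT1 t)) :
    colim_comparison (coextension h) X g (psi t g n) = rk1 t g _ n.
  move: n; apply: colim_car_ext => [x y|x y|j n].
  - by rewrite psiD hfunD.
  - exact: rk1D.
  - by rewrite psi_colim [LHS]colim_comparison_in [LHS]rk1_hom.
pose inv g (u : coextension h (colim X) g) : colim Y g :=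
  \sum_(t <- s) psi t g ((u : grHom T (shift g (colim X))) _ (projT2 t).1).
apply: (@colim_comparison_iso _ _ _ _ _ X inv) => [g u v|j g u|g u].
- by rewrite /inv -big_split; apply: eq_bigr => t _; apply: psiD.
- rewrite /inv [in RHS](rk1E g _ u) hfun_sum.
  by apply: eq_bigr => t _; rewrite [LHS]psi_colim.
- exists (inv g u); rewrite /inv hfun_sum [RHS](rk1E g _ u).
  by apply: eq_bigr => t _; apply: psi_comp.
Qed.

End CoextensionColim.

(** * Right exactness and finite presentation *)

Section ZQuotient.
Variables (A : zmodType) (H : A -> Prop).
Hypotheses (H0 : H 0) (HD : forall x y, H x -> H y -> H (x + y))
  (HN : forall x, H x -> H (- x)).

Inductive zquot_rel : zexpr A -> zexpr A -> Prop :=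
| zquot_relD x y : zquot_rel (ZGen (x + y)) (ZAdd (ZGen x) (ZGen y))
| zquot_rel0 x : H x -> zquot_rel (ZGen x) ZZero.

Definition zquot : zmodType := zpres zquot_rel.
Definition zquot_pi (x : A) : zquot := zgen zquot_rel x.

Lemma zquot_piD : {morph zquot_pi : x y / x + y}.
Proof.
by move=> x y; rewrite /zquot_pi /zgen -zpiD; apply/zpi_eq/zcong_rel/zquot_relD.
Qed.

Lemma zquot_pi_eq x y : H (x - y) -> zquot_pi x = zquot_pi y.
Proof.
move=> Hxy; apply/eqP; rewrite -subr_eq0 -(morph_addB zquot_piD).
by apply/eqP/zpi_eq/zcong_rel/zquot_rel0.
Qed.

(** Evaluated in A, congruent expressions differ by an element of H: this holds for the relations
    and passes through each congruence rule. *)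
Lemma zquot_pi_eq0 x : zquot_pi x = 0 -> H x.
Proof.
move=> /zpi_eq; rewrite -{2}[x]subr0.
suff eH u v : zcong zquot_rel u v -> H (zeval id u - zeval id v) by move/eH.
elim=> {u v} /= [u v|u|u v _ Huv|u v w _ Huv _ Hvw|u v _ Huv|||||].
- by case=> [x1 y1|x1 Hx1] /=; rewrite ?subrr ?subr0.
- by rewrite subrr.
- by rewrite -opprB; apply: HN.
- by rewrite -(subrKA (zeval id v)); apply: HD.
- by rewrite -opprD; apply: HN.
- by move=> u u' v v' _ Hu _ Hv; rewrite opprD addrACA; apply: HD.
- by move=> u v w; rewrite addrA subrr.
- by move=> u v; rewrite (addrC (zeval id v)) subrr.
- by move=> u; rewrite add0r subrr.
- by move=> u; rewrite addNr subr0.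
Qed.

End ZQuotient.

Section LeftMap.
Variables (G : zmodType) (R : grRing G).
Implicit Types M N P L Q : grMod R.

Section Map.
Variables (M M' N : grMod R) (w : grHom M M').

Definition ltmap_fun k p q (e : p + q = k) (x : M p) (y : N q) : tens M' N k :=
  tmk e (w p x) y.

Lemma ltmap_balanced k : tens_balanced (@ltmap_fun k).
Proof.
split=> [p q e x x' y|p q e x y y'|a p q ap aq e1 e2 e3 e4 r x y].
- by rewrite /ltmap_fun hfunD tmkDl.
- exact: tmkDr.
- by rewrite /ltmap_fun hfunZ; apply: tmkZ.
Qed.

Definition ltmap k : tens M N k -> tens M' N k := tens_lift (@ltmap_fun k).

Lemma ltmap_mk k p q (e : p + q = k) (x : M p) (y : N q) :
  ltmap (tmk e x y) = tmk e (w p x) y.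
Proof. exact: (tens_lift_mk (@ltmap_balanced k)). Qed.

Lemma ltmapD k : {morph @ltmap k : x y / x + y}.
Proof. exact: (tens_liftD (@ltmap_balanced k)). Qed.

End Map.

Lemma ltmap_comp M M' M'' N (v : grHom M' M'') (w : grHom M M') k
    (z : tens M N k) : ltmap (hcomp v w) z = ltmap v (ltmap w z).
Proof.
move: z; apply: tens_ext => [|x y|p q e x y]; first exact: ltmapD.
  by rewrite !ltmapD.
by rewrite !ltmap_mk.
Qed.

Lemma ltmap0 M M' N k (z : tens M N k) : ltmap (0 : grHom M M') z = 0.
Proof.
move: z; apply: (@tens_ext _ _ _ _ _ _ _ (fun=> 0)) => [|x y|p q e x y].
- exact: ltmapD.
- by rewrite addr0.
- by rewrite ltmap_mk tmk0l.
Qed.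

Lemma ltmap_tmap M M' N N' (w : grHom M M') (u : grHom N N') k
    (z : tens M N k) : ltmap w (tmap u z) = tmap u (ltmap w z).
Proof.
move: z; apply: tens_ext => [x y|x y|p q e x y].
- by rewrite tmapD ltmapD.
- by rewrite ltmapD tmapD.
- by rewrite tmap_mk !ltmap_mk tmap_mk.
Qed.

Lemma ltmap_surj M M' N (w : grHom M M') k (z : tens M' N k) :
  gr_surjective w -> exists z', ltmap w z' = z.
Proof.
move=> wsurj; elim/zpres_ind: z => [[p q e x y]||_ [z <-]|_ _ [z <-] [z' <-]].
- by have [x' <-] := wsurj _ x; exists (tmk e x' y); rewrite ltmap_mk.
- by exists 0; rewrite (morph_add0 (@ltmapD _ _ _ _ _)).
- by exists (- z); rewrite (morph_addN (@ltmapD _ _ _ _ _)).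
- by exists (z + z'); rewrite ltmapD.
Qed.

(* Choosing preimages under p gives a well-defined map from M (x) N to the    *)
(* quotient of L (x) N by the image of Q (x) N.                               *)
Lemma ltmap_exact Q L M N (q : grHom Q L) (p : grHom L M) k (z : tens L N k) :
  gr_exact q p -> gr_surjective p -> ltmap p z = 0 -> exists v, ltmap q v = z.
Proof.
move=> qp psurj.
pose H (x : tens L N k) := exists v : tens Q N k, ltmap q v = x.
have H0 : H 0 by exists 0; rewrite (morph_add0 (@ltmapD _ _ _ _ _)).
have HD x y : H x -> H y -> H (x + y).
  by move=> [v <-] [v' <-]; exists (v + v'); rewrite ltmapD.
have HN x : H x -> H (- x).
  by move=> [v <-]; exists (- v); rewrite (morph_addN (@ltmapD _ _ _ _ _)).
pose sec a (x : M a) := projT1 (cid (psurj a x)).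
have secK a (x : M a) : p a (sec a x) = x by rewrite /sec; case: cid.
pose f a b (e : a + b = k) (x : M a) (y : N b) : zquot H :=
  zquot_pi H (tmk e (sec a x) y).
(* Two preimages under p differ by an element of the image of q, so the class does not depend on the
   choice. *)
have fE a b (e : a + b = k) (x : L a) (y : N b) :
    f a b e (p a x) y = zquot_pi H (tmk e x y).
  apply: zquot_pi_eq; have /qp [t tE] : p a (sec a (p a x) - x) = 0.
    by rewrite hfunB secK subrr.
  exists (tmk e t y); rewrite ltmap_mk tE.
  by apply: (@morph_addB _ _ (fun x : L a => tmk e x y)) => x1 x2; apply: tmkDl.
have fB : tens_balanced f.
  split=> [a b e x x' y|a b e x y y'|c a b ca cb e1 e2 e3 e4 r x y].
  - by rewrite -(secK _ x) -(secK _ x') -hfunD !fE tmkDl zquot_piD.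
  - by rewrite -(secK _ x) !fE tmkDr zquot_piD.
  - by rewrite -(secK _ x) -hfunZ !fE (tmkZ e1 e2 e3 e4).
have fz : tens_lift f (ltmap p z) = zquot_pi H z.
  move: z; apply: tens_ext => [x y|x y|a b e x y].
  - by rewrite ltmapD (tens_liftD fB).
  - exact: zquot_piD.
  - by rewrite ltmap_mk (tens_lift_mk fB) fE.
move=> z0; apply: (zquot_pi_eq0 H0 HD HN).
by rewrite -fz z0 (morph_add0 (tens_liftD fB)).
Qed.

(** * Tensor products of infinite products *)

Definition tens_prod_inj M : Prop :=
  forall (J : Type) (N : J -> grMod R) k (z : tens M (gprod N) k),
    (forall j, tmap (gprod_proj N j) z = 0) -> z = 0.

Definition tens_prod_surj M : Prop :=
  forall (J : Type) (N : J -> grMod R) k (y : forall j, tens M (N j) k),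
    exists z : tens M (gprod N) k, forall j, tmap (gprod_proj N j) z = y j.

Lemma dual_basis_tens_prod M :
  dual_basis M -> tens_prod_inj M /\ tens_prod_surj M.
Proof.
move=> [s sE]; split=> J N k.
  move=> z z0; rewrite (dual_basis_contract z sE) big1 // => t _.
  suff -> : contract (projT2 t).2 z = 0 by apply: tmk0r.
  apply: functional_extensionality_dep => j.
  rewrite -[LHS]/(gprod_proj N j _ _) -contract_natural z0.
  exact: (morph_add0 (@contractD _ _ _ _ _ _ _)).
move=> y; pose n (t : dual_pair M) : gprod N (projT1 t + k) :=
  fun j => contract (projT2 t).2 (y j).
exists (\sum_(t <- s) tpure (projT2 t).1 (n t)) => j.
rewrite tmap_sum [RHS](dual_basis_contract (y j) sE).
by apply: eq_bigr => t _; rewrite tmap_tpure.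
Qed.

(** A diagram chase on Q -> L -> M -> 0: surjectivity passes from L to M, and injectivity for M
    follows from injectivity for L together with surjectivity for Q. *)
Lemma finite_presentation_tens_prod M :
  finite_presentation M -> tens_prod_inj M /\ tens_prod_surj M.
Proof.
move=> [Q [L [q [p [Qfree Lfree qp psurj]]]]].
have [_ Qs] := dual_basis_tens_prod (free_finite_rank_dual_basis Qfree).
have [Li Ls] := dual_basis_tens_prod (free_finite_rank_dual_basis Lfree).
split=> J N k.
  move=> z z0; have [w wE] := ltmap_surj z psurj.
  (* Each component of w dies in M (x) N_j, hence comes from Q (x) N_j; surjectivity for Q collects
     these lifts into a single v. *)
  have wj j : exists v, ltmap q v = tmap (gprod_proj N j) w.
    by apply: (ltmap_exact qp psurj); rewrite ltmap_tmap wE z0.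
  have [v vE] := Qs J N k (fun j => projT1 (cid (wj j))).
  have pq0 : hcomp p q = 0.
    by apply: grHom_ext => g x; apply/(qp g); exists x.
  rewrite -wE; suff <- : ltmap q v = w by rewrite -ltmap_comp pq0 ltmap0.
  apply/eqP; rewrite -subr_eq0; apply/eqP/Li => j.
  rewrite (morph_addB (@tmapD _ _ _ _ _ _ _)) -ltmap_tmap vE.
  by case: cid => x /= ->; rewrite subrr.
move=> y; have yj j := ltmap_surj (y j) psurj.
have [w wE] := Ls J N k (fun j => projT1 (cid (yj j))).
by exists (ltmap p w) => j; rewrite -ltmap_tmap wE; case: cid.
Qed.

Lemma unit_tens_evaluate M g (x : M g) :
  evaluate (addr0 g) (unit_tens x) = x.
Proof. by rewrite /unit_tens evaluate_mk (act_one_cast _ _ erefl). Qed.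

(** Evaluating the j-th component gives x_j as a combination of the left factors, a finite list that
    does not depend on j. *)
Lemma unit_tens_span M (J : Type) (d : J -> G) (x : forall j, M (d j))
    (s : seq {c : G & (M (- c) *
      gprod (fun j => shift (d j) (grself R)) (c + 0)%R)%type}) :
  (forall j, tmap (gprod_proj (fun j => shift (d j) (grself R)) j)
     (\sum_(t <- s) tpure (projT2 t).1 (projT2 t).2) = unit_tens (x j)) ->
  forall j, exists r : forall t, shift (projT1 t) (grself R) (d j),
    x j = \sum_(t <- s) free_hom (projT2 t).1 (d j) (r t).
Proof.
move=> xE j.
have deg c : d j + (c + 0) = c + d j by rewrite addr0 addrC.
exists (fun t => gcast (C := R) (deg (projT1 t)) ((projT2 t).2 j)).
rewrite -[LHS]unit_tens_evaluate -xE tmap_sum.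
rewrite (morph_add_sum _ _ _ (@evaluateD _ _ _ _ _ _ _)).
apply: eq_bigr => t _; rewrite tmap_tpure evaluate_mk.
by symmetry; apply: act_castl.
Qed.

Lemma tens_prod_surj_finite_type M : tens_prod_surj M -> finite_type M.
Proof.
move=> Ms; pose J : Type := {g : G & M g}.
have [z zE] := Ms J (fun j => shift (projT1 j) (grself R)) 0
  (fun j => unit_tens (projT2 j)).
have [s sE] := tens_sum z; rewrite sE in zE.
have [L [p [Lfree psurj _]]] := finite_span (fun t => (projT2 t).1) s.
exists L, p; split=> // g x.
have [r rE] := unit_tens_span zE (existT (fun g => M g : Type) g x : J).
by have [y yE] := psurj g r; exists y; rewrite yE -rE.
Qed.

(** One free generator is taken for each homogeneous element of the kernel; this provides the exact
    sequence to which [ltmap_exact] applies. *)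
Lemma kernel_cover L M (p : grHom L M) :
  exists (Q : grMod R) (q : grHom Q L), gr_exact q p.
Proof.
pose J : Type := {c : G & {x : L (- c) | p _ x = 0}}.
pose q (j : J) : grHom (shift (projT1 j) (grself R)) L :=
  free_hom (projT1 (projT2 j)).
exists (gsum (fun j : J => shift (projT1 j) (grself R))), (gsum_lift q).
move=> g y; split=> [py|[x <-]].
  have e : g = - - g by rewrite opprK.
  have py' : p _ (gcast (C := L) e y) = 0.
    rewrite (gcast_hom p) py; exact: (morph_add0 (@gcastD _ M _ _ _)).
  pose j : J :=
    existT (fun c => {x : L (- c) | p _ x = 0}) (- g) (exist _ _ py').
  exists (gcast (C := gsum (fun j : J => shift (projT1 j) (grself R)))
     (esym e) (gsum_in _ j _ (unit_shift R (- g)))).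
  rewrite (gcast_hom (gsum_lift q)) -[gsum_lift q _ _]/(gsum_lift_fun _ _).
  rewrite gsum_lift_in_fun /q free_hom1 /= (gcast_comp _ _ (erefl g)) //.
rewrite -[LHS]/(hcomp p (gsum_lift q) g x).
suff -> : hcomp p (gsum_lift q) = 0 by [].
apply: gsum_ext => j; apply: grHom_ext => k r /=.
rewrite gsum_lift_in_fun [LHS](free_hom_hcomp p) (projT2 (projT2 j)).
exact: act0.
Qed.

Lemma tens_prod_finite_presentation M :
  tens_prod_inj M -> tens_prod_surj M -> finite_presentation M.
Proof.
move=> Mi /tens_prod_surj_finite_type [L [p [Lfree psurj]]].
have [_ Ls] := dual_basis_tens_prod (free_finite_rank_dual_basis Lfree).
pose J : Type := {g : G & {x : L g | p g x = 0}}.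
pose x (j : J) : L (projT1 j) := projT1 (projT2 j).
have [w wE] := Ls J (fun j => shift (projT1 j) (grself R)) 0
  (fun j => unit_tens (x j)).
have [Q [q qp]] := kernel_cover p.
(* The components of w become p(x_j) (x) 1 = 0 in M (x) R(deg x_j), so injectivity for M kills the
   image of w. *)
have [v vE] : exists v, ltmap q v = w.
  apply: (ltmap_exact qp psurj); apply: Mi => j.
  rewrite -ltmap_tmap wE /unit_tens ltmap_mk (projT2 (projT2 j)).
  exact: tmk0l.
have [s sE] := tens_sum v.
pose E : Type := {c : G & (Q (- c) *
  gprod (fun j : J => shift (projT1 j) (grself R)) (c + 0)%R)%type}.
pose F c : Type := (L (- c) *
  gprod (fun j : J => shift (projT1 j) (grself R)) (c + 0)%R)%type.
(* Pushing the left factors of v through q rewrites w with left factors in the kernel of p; these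
   are the finitely many relations. *)
pose qE (t : E) := existT F (projT1 t) (q _ (projT2 t).1, (projT2 t).2).
pose qs := [seq qE t | t <- s].
have wqs : w = \sum_(t <- qs) tpure (projT2 t).1 (projT2 t).2.
  rewrite -vE sE (morph_add_sum _ _ _ (@ltmapD _ _ _ _ _)) big_map.
  by apply: eq_bigr => t _; apply: ltmap_mk.
have xE := unit_tens_span (x := x) (s := qs).
rewrite -wqs in xE; have {}xE := xE wE.
have [L' [q' [L'free q'surj q'0]]] :=
  finite_span (fun t : E => q _ (projT2 t).1) s.
exists L', L, q', p; split=> // g y; split=> [py|[t <-]].
  pose j : J := existT (fun g => {x : L g | p g x = 0}) g (exist _ y py).
  have [r rE] := xE j.
  have [t tE] := q'surj g (fun t => r (qE t)).
  by exists t; rewrite tE [RHS]rE big_map.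
rewrite -[LHS]/(hcomp p q' g t) q'0 // => e.
by apply/(qp _); exists (projT2 e).1.
Qed.

End LeftMap.

Lemma extension_prodP (G : zmodType) (R S : grRing G) (h : grRingHom R S) :
  commutes_with_products (extension h) <-> finite_presentation (restrS h).
Proof.
split=> [H|/finite_presentation_tens_prod [Ti Ts] J N].
  apply: tens_prod_finite_presentation => J N k.
    have /is_isoP [cinj _] := H J N; move=> z z0; apply: (cinj k).
    rewrite hfun0; exact: functional_extensionality_dep.
  have /is_isoP [_ csurj] := H J N; move=> y.
  have [z zE] := csurj k y; exists z => j.
  exact: (congr1 (fun y : gprod (fun j => extension h (N j)) k => y j) zE).
apply/is_isoP; split=> k.
  apply: morph_add_inj => [|z z0]; first exact: hfunD.
  apply: (Ti J N) => j.
  exact: (congr1 (fun y : gprod (fun j => extension h (N j)) k => y j) z0).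
move=> y; have [z zE] := Ts J N k y; exists z.
exact: functional_extensionality_dep.
Qed.

Theorem mainTheorem6 (G : zmodType) (R S : grRing G) (h : grRingHom R S) :
  [/\ commutes_with_inductive_limits (restriction h),
      commutes_with_projective_limits (restriction h),
      commutes_with_inductive_limits (extension h)
    & commutes_with_projective_limits (coextension h)] /\
  [/\ exact_functor (extension h) <-> flat (restrS h),
      commutes_with_products (extension h) <->
        finite_presentation (restrS h)
    & commutes_with_projective_limits (extension h) <->
        projective (restrS h) /\ finite_type (restrS h)] /\
  [/\ exact_functor (coextension h) <-> projective (restrS h),
      commutes_with_sums (coextension h) <-> small (restrS h)
    & commutes_with_inductive_limits (coextension h) <->
        projective (restrS h) /\ finite_type (restrS h)].
Proof.
split; last split; split.
- exact: restriction_colim.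
- exact: restriction_lim.
- exact: extension_colim.
- exact: coextension_lim.
- exact: extension_exactP.
- exact: extension_prodP.
- rewrite -dual_basisP; split; first exact: extension_lim_dual_basis.
  exact: dual_basis_extension_lim.
- exact: coextension_exactP.
- exact: coextension_sumP.
- rewrite -dual_basisP; split; first exact: coextension_colim_dual_basis.
  exact: dual_basis_coextension_colim.
Qed.
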